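(* Let $G'=(V',E')$ be a finite directed multigraph with $V'=\{1,\dots,v'\}$, $e'=|E'|$ edges, no loops and no isolated nodes. Let $f:\mathbf{N}\to\mathbf{N}$ satisfy $f(0)=e'$, $f(t)=0$ for $1\le t\le v'-1$, $f(t)\ge 1$ for $t\ge v'$, and suppose $f(t)=\Theta(t)$, i.e. there are constants $c_2\ge c_1>0$ with $c_1 t\le f(t)\le c_2 t$ for all sufficiently large $t$. Run the process $\mathrm{MPA}_f(G')$ (described in the context). Then, with probability $1$, the infinite limit of the process, regarded as an undirected multigraph, is isomorphic to the Rado multigraph.
   Context: The process $\mathrm{MPA}_f(G')$: set $G(1)=\dots=G(v')=G'$. Let $F(t)=\sum_{i=0}^{t-1}f(i)$, which equals the number of edges of $G(t)$. For $t\ge v'$, $G(t+1)$ is obtained from $G(t)$ (with node set $\{1,\dots,t\}$) by adding a new node $t+1$ together with $f(t)$ new directed edges, each starting at $t+1$; the end-points of these edges are chosen independently (with replacement) from $\{1,\dots,t\}$, each end-point being node $u$ with probability $d_u(t)/(2F(t))$, where $d_u(t)$ is the degree of $u$ in $G(t)$ (counting edge multiplicities, ignoring direction). The infinite limit is the multigraph on node set $\{1,2,3,\dots\}$ whose edge multiset is the union of those of all $G(t)$; it is regarded as an undirected multigraph, i.e. as a structure in the language $\langle E_j: j\in\mathbf{N}\rangle$ where $E_j(u,v)$ means that there are at least $j$ edges (in either direction) between $u$ and $v$. The Rado multigraph is the (unique up to isomorphism) countably infinite structure in this language satisfying: (A0) $E_0(x,y)$ for all $x\ne y$; (A1) each $E_j$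 is symmetric and irreflexive; (A2) $E_{j+1}(u,v)\Rightarrow E_j(u,v)$ for all $j$; (A3) for all $u,v$ there is $i$ with $\neg E_i(u,v)$; (A4) for every $n$, all $m_1,\dots,m_n\in\mathbf{N}$ and all pairwise distinct $u_1,\dots,u_n$, there exists $v$ with $E_{m_i}(u_i,v)$ and $\neg E_{m_i+1}(u_i,v)$ for every $i$ (i.e. $v$ is joined to each $u_i$ by exactly $m_i$ edges). *)

(* Defs.v *)
From HB Require Import structures.
From mathcomp Require Import all_boot all_order all_algebra.
From mathcomp Require Import all_classical all_reals all_analysis.

Set Implicit Arguments.
Unset Strict Implicit.
Unset Printing Implicit Defensive.

Import Order.TTheory GRing.Theory Num.Theory.
Local Open Scope classical_set_scope.
Local Open Scope ring_scope.

(* Structures in the language <E_j : j in N> with carrier V. *)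
Definition mstruct (V : Type) := nat -> V -> V -> Prop.

Definition miso (V W : Type) (M : mstruct V) (N : mstruct W) : Prop :=
  exists2 phi : V -> W, bijective phi &
    forall (j : nat) (u v : V), M j u v <-> N j (phi u) (phi v).

Record Rado_multigraph (V : Type) (E : mstruct V) : Prop := RadoMultigraph {
  Rado_countable : countable [set: V];
  Rado_infinite : infinite_set [set: V];
  Rado_A0 : forall x y : V, x <> y -> E 0%N x y;
  Rado_A1_sym : forall (j : nat) (x y : V), E j x y -> E j y x;
  Rado_A1_irr : forall (j : nat) (x : V), ~ E j x x;
  Rado_A2 : forall (j : nat) (u v : V), E j.+1 u v -> E j u v;
  Rado_A3 : forall u v : V, exists i : nat, ~ E i u v;
  Rado_A4 : forall (n : nat) (m : 'I_n -> nat) (u : 'I_n -> V), injective u ->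
    exists v : V, forall i : 'I_n, E (m i) (u i) v /\ ~ E (m i).+1 (u i) v }.

(* A finite directed multigraph is given by the list of its edges
   (start, end); its nodes 1, ..., v are specified separately. *)
Definition dmultigraph := seq (nat * nat).

Definition dmultigraph_on (v : nat) (E : dmultigraph) : Prop :=
  forall e, e \in E -> (1 <= e.1 <= v)%N && (1 <= e.2 <= v)%N.

Definition loopless (E : dmultigraph) : Prop :=
  forall e, e \in E -> e.1 != e.2.

Definition no_isolated (v : nat) (E : dmultigraph) : Prop :=
  forall u : nat, (1 <= u <= v)%N -> exists2 e, e \in E & (e.1 == u) || (e.2 == u).

Definition degree (E : dmultigraph) (u : nat) : nat :=
  (count (fun e => e.1 == u) E + count (fun e => e.2 == u) E)%N.

Definition multiplicity (E : dmultigraph) (u v : nat) : nat :=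
  count (fun e => (e == (u, v)) || (e == (v, u))) E.

(* [h t i] is the end-point of the [i]-th (0 <= i < f t) of the edges added
   together with node t+1.  [MPA_graph v' E' f h t] is G(t), for t >= 1. *)
Fixpoint MPA_graph (v' : nat) (E' : dmultigraph) (f : nat -> nat)
    (h : nat -> nat -> nat) (t : nat) : dmultigraph :=
  if t is s.+1 then
    if (v' <= s)%N then
      MPA_graph v' E' f h s ++ [seq (s.+1, h s i) | i <- iota 0 (f s)]
    else E'
  else E'.

Definition cumul (f : nat -> nat) (t : nat) : nat := (\sum_(0 <= i < t) f i)%N.

(* The event that the random end-points chosen in the construction of G(t)
   are those prescribed by h. *)
Definition MPA_history (T : Type) (v' : nat) (f : nat -> nat)
    (X : nat -> nat -> T -> nat) (h : nat -> nat -> nat) (t : nat) : set T :=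
  [set w | forall s i : nat, (v' <= s < t)%N -> (i < f s)%N -> X s i w = h s i].

(* The random end-points X realise the process: conditionally on the choices
   made up to G(t), the f(t) end-points of the edges from node t+1 are
   independent, each being u with probability d_u(t) / (2 F(t)).  The condition
   P(A | past) = p is written P(A and past) = P(past) p. *)
Definition is_MPA (d : measure_display) (T : measurableType d) (R : realType)
    (P : probability T R) (v' : nat) (E' : dmultigraph) (f : nat -> nat)
    (X : nat -> nat -> {RV P >-> nat}) : Prop :=
  (forall (t i : nat) (w : T), (v' <= t)%N -> (i < f t)%N ->
    (1 <= X t i w <= t)%N) /\
  (forall (t : nat) (h : nat -> nat -> nat), (v' <= t)%N ->
    P (MPA_history v' f X h t.+1) =
    (P (MPA_history v' f X h t) *
     (\prod_(i < f t) ((degree (MPA_graph v' E' f h t) (h t i))%:R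
                       / (2 * cumul f t)%:R))%:E)%E).

Definition node := {n : nat | (0 < n)%N}.

(* The infinite limit, as an undirected multigraph.  The G(t) form an
   increasing chain of edge multisets, so their union has at least j edges
   between u and v iff some G(t) does.  The conjunct u <> v only matters for
   j = 0, where it makes E_0 irreflexive. *)
Definition MPA_limit (v' : nat) (E' : dmultigraph) (f : nat -> nat)
    (h : nat -> nat -> nat) : mstruct node :=
  fun j u v => u <> v /\
    exists2 t : nat, (1 <= t)%N &
      (j <= multiplicity (MPA_graph v' E' f h t) (val u) (val v))%N.

Definition Theta_linear (R : realType) (f : nat -> nat) : Prop :=
  exists c1 c2 : R, [/\ 0 < c1, c1 <= c2 &
    exists t0 : nat, forall t : nat, (t0 <= t)%N ->
      c1 * t%:R <= (f t)%:R <= c2 * t%:R].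

(* Rado multigraphs exist: on nat, let the multiplicity of {a < b} be the a-th
   entry of the finite sequence coded by b. *)
Lemma Rado_multigraph_exists : exists E : mstruct nat, Rado_multigraph E.
Proof.
pose mu a b := nth 0%N (CodeSeq.decode (maxn a b)) (minn a b).
exists (fun j a b => a <> b /\ (j <= mu a b)%N); split.
- exact: countableP.
- exact: infinite_nat.
- by move=> x y.
- move=> j x y [xy jxy]; split; first by move=> yx; apply: xy.
  by rewrite /mu maxnC minnC.
- by move=> j x [].
- by move=> j u v [uv juv]; split=> //; exact: ltnW.
- by move=> u v; exists (mu u v).+1 => -[_]; rewrite ltnn.
- move=> n m u injU.
  pose M := (\max_(i < n) u i).+1.
  have uM i : (u i < M)%N by rewrite ltnS (leq_bigmax i).
  pose e k := if [pick i | u i == k] is Some i then m i else 0%N.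
  pose s := rcons (mkseq e M) M.
  have sM : (M < CodeSeq.code s)%N.
    by have /allP := CodeSeq.ltn_code s; apply; rewrite mem_rcons inE eqxx.
  exists (CodeSeq.code s) => i.
  have us : (u i < CodeSeq.code s)%N := ltn_trans (uM i) sM.
  have -> : mu (u i) (CodeSeq.code s) = m i.
    rewrite /mu (maxn_idPr (ltnW us)) (minn_idPl (ltnW us)) CodeSeq.codeK.
    rewrite /s nth_rcons size_mkseq uM nth_mkseq // /e.
    by case: pickP => [k /eqP/injU -> //|/(_ i)]; rewrite eqxx.
  split; last by case; rewrite ltnn.
  by split=> // ue; move: us; rewrite -ue ltnn.
Qed.

(* Main.v *)
(* A back-and-forth argument shows that two Rado multigraphs are isomorphic, so
   it suffices to prove that the limit satisfies (A4) almost surely; the other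
   axioms hold for every outcome.

   Let F be the number of edges, r = f / 2F, and d the degree of a node u.  In
   one step E[d] is multiplied by 1 + r, hence E[d(t)] = O(sqrt F(t)) = O(t).
   For g(d) = Gamma(d - 1/2) / Gamma(d), of order d^(-1/2), the complete
   monotonicity of g yields that E[g(d)] is multiplied by at most
   1 - r/2 + 3 r^2 / 8 <= (1 + 2 r)^(-1/4), so that E[g(d)] F^(1/4) is eventually
   nonincreasing and E[g(d(t))] = O(t^(-1/2)).  By Markov's inequality the ratios
   d(t)/t and t/d(t) are tight.

   When the degrees of given nodes u_i are all of order t, the number of new
   edges to u_i has mean of order 1, and the new node is joined to each u_i by
   exactly m_i edges with conditional probability at least delta > 0.  If with
   probability beta > 0 this never happened after time t0, then at each late time
   it fails so far and the degrees are of order t with probability at least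
   beta / 2, so the probability of not having succeeded yet would decrease by
   delta beta / 2 at each step, forever. *)

Require Import Defs.
From HB Require Import structures.
From mathcomp Require Import all_boot all_order all_algebra.
From mathcomp Require Import all_classical all_reals all_analysis.
From mathcomp Require Import zify ring lra.

Set Implicit Arguments.
Unset Strict Implicit.
Unset Printing Implicit Defensive.
Import Order.TTheory GRing.Theory Num.Theory.
Local Open Scope classical_set_scope.
Local Open Scope ring_scope.

(** * Uniqueness of the Rado multigraph *)

(** The multiplicity of a pair is one less than the least failing index, which (A0) makes positive
    off the diagonal. Irreflexivity keeps the node provided by (A4) out of [s]. *)
Lemma Rado_mult (V : eqType) (E : mstruct V) : Rado_multigraph E ->
  exists2 mu : V -> V -> nat,
    forall j u v, E j u v <-> u != v /\ (j <= mu u v)%N &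
    forall (s : seq V) (m : V -> nat),
      exists2 v, v \notin s & forall u, u \in s -> mu u v = m u.
Proof.
move=> radoE.
have exI u v : exists i, `[< ~ E i u v >].
  by have [i ?] := Rado_A3 radoE u v; exists i; apply/asboolP.
pose mu u v := (ex_minn (exI u v)).-1.
have E0 u v : u != v -> E 0%N u v by move/eqP; exact: Rado_A0.
have Ele u v i j : (i <= j)%N -> E j u v -> E i u v.
  move=> /subnK <-; elim: (j - i)%N => // k IH; rewrite addSn.
  by move/(Rado_A2 radoE).
have Emu j u v : E j u v <-> u != v /\ (j <= mu u v)%N.
  split=> [Ej|[uv]].
    have uv : u != v.
      by apply/eqP => uv; apply: (Rado_A1_irr radoE) (v) _; rewrite uv in Ej; exact: Ej.
    split=> //; rewrite /mu; case: ex_minnP => -[|i] /asboolP nE _.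
      by case: nE; exact: E0.
    by rewrite /= leqNgt; apply/negP => ij; apply: nE; exact: Ele Ej.
  rewrite /mu; case: ex_minnP => -[|i] /asboolP nE imin /=.
    by case: nE; exact: E0.
  move=> ji; apply: contrapT => /asboolP/imin; lia.
exists mu => // s m.
(* (A4) takes an injective family, so repetitions in [s] are removed first. *)
have [v vP] := Rado_A4 radoE (fun i => m (tnth (in_tuple (undup s)) i))
  (elimT (tuple_uniqP (in_tuple (undup s))) (undup_uniq s)).
have {}vP u : u \in s -> u != v /\ mu u v = m u.
  rewrite -mem_undup => us.
  have /tnthP[i ui] : u \in in_tuple (undup s) by [].
  have := vP i; rewrite -ui => -[/Emu[uv le1] nle]; split => //.
  apply/eqP; rewrite eqn_leq le1 andbT leqNgt; apply/negP => lt.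
  by apply: nle; apply/Emu.
by exists v => [|u /vP[]//]; apply/negP => /vP[]; rewrite eqxx.
Qed.

Section BackAndForth.
Variables (V W : eqType) (mu : V -> V -> nat) (nu : W -> W -> nat).

(** The equality clause says at once that the finite relation is a function and that it is
    injective; diagonal multiplicities carry no information and are not compared. *)
Definition partial_iso (l : seq (V * W)) : Prop :=
  forall p q, p \in l -> q \in l ->
    (p.1 == q.1) = (p.2 == q.2) /\ (p.1 != q.1 -> mu p.1 q.1 = nu p.2 q.2).

Hypothesis mu_sym : forall u v, u != v -> mu u v = mu v u.
Hypothesis nu_sym : forall u v, u != v -> nu u v = nu v u.

Lemma partial_iso_forth l a :
  (forall (s : seq W) (m : W -> nat),
     exists2 v, v \notin s & forall u, u \in s -> nu u v = m u) ->
  partial_iso l -> exists b, partial_iso ((a, b) :: l).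
Proof.
move=> nu_ext lP; have [/hasP[[a' b] abl /= /eqP aa]|aN] := boolP (has (fun p => p.1 == a) l).
  exists b => p q; rewrite !inE => /orP[/eqP->|pl] /orP[/eqP->|ql]; apply: lP => //;
    by rewrite -aa.
have aN' p : p \in l -> p.1 != a by move=> pl; apply: contra aN => ?; apply/hasP; exists p.
(* [m] transports to the images the multiplicities that [a] has with their preimages. Injectivity
   makes the choice of preimage irrelevant, and the value [0] is never read at an image. *)
pose m b := if [seq p <- l | p.2 == b] is p :: _ then mu p.1 a else 0%N.
have [b bN bP] := nu_ext [seq p.2 | p <- l] m.
have {}bN p : p \in l -> p.2 != b.
  by move=> pl; apply: contra bN => /eqP <-; exact: map_f.
have {}bP p : p \in l -> mu p.1 a = nu p.2 b.
  move=> pl; rewrite bP ?map_f // /m.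
  case E: [seq p0 <- l | _] => [|q s].
    have : p \in [seq p0 <- l | p0.2 == p.2] by rewrite mem_filter eqxx.
    by rewrite E.
  have : q \in [seq p0 <- l | p0.2 == p.2] by rewrite E mem_head.
  rewrite mem_filter => /andP[qp ql].
  by have [] := lP q p ql pl; rewrite qp => /eqP ->.
exists b => p q; rewrite !inE => /orP[/eqP->|pl] /orP[/eqP->|ql] /=.
- by rewrite !eqxx.
- rewrite ![_ == q.1]eq_sym ![b == _]eq_sym !(negbTE (aN' _ ql)) (negbTE (bN _ ql)).
  split=> // _; rewrite mu_sym 1?eq_sym ?aN' // bP // nu_sym //; exact: bN.
- by rewrite (negbTE (aN' _ pl)) (negbTE (bN _ pl)) bP.
- exact: lP.
Qed.

End BackAndForth.

Lemma partial_iso_swap (V W : eqType) (mu : V -> V -> nat) (nu : W -> W -> nat) l :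
  partial_iso mu nu l -> partial_iso nu mu [seq (p.2, p.1) | p <- l].
Proof.
move=> lP _ _ /mapP[p pl ->] /mapP[q ql ->] /=; have [e h] := lP p q pl ql.
by split=> // ne; rewrite h // e.
Qed.

(** Back-and-forth along numberings of both carriers: the union of a chain of finite partial
    isomorphisms is the graph of the isomorphism. *)
Lemma Rado_unique_eqType (V W : eqType) (E : mstruct V) (F : mstruct W) :
  Rado_multigraph E -> Rado_multigraph F -> miso E F.
Proof.
move=> radoE radoF.
have [mu muP mu_ext] := Rado_mult radoE; have [nu nuP nu_ext] := Rado_mult radoF.
have sym (U : eqType) (G : mstruct U) (ka : U -> U -> nat) : Rado_multigraph G ->
    (forall j u v, G j u v <-> u != v /\ (j <= ka u v)%N) ->
    forall u v, u != v -> ka u v = ka v u.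
  move=> radoG kaP u v uv; apply/eqP; rewrite eqn_leq; apply/andP; split.
    by have /kaP[] : G (ka u v) v u by apply/(Rado_A1_sym radoG)/kaP.
  have /kaP[] // : G (ka v u) u v.
  by apply/(Rado_A1_sym radoG)/kaP; rewrite eq_sym.
have mu_sym := sym _ _ _ radoE muP; have nu_sym := sym _ _ _ radoF nuP.
have /countable_injP[eV eV_inj] := Rado_countable radoE.
have /countable_injP[eW eW_inj] := Rado_countable radoF.
pose P := partial_iso mu nu.
have forth l n : P l -> exists l', [/\ P l', {subset l <= l'} &
    forall a, eV a = n -> exists b, (a, b) \in l'].
  move=> lP; have [[a an]|na] := pselect (exists a, eV a = n); last first.
    by exists l; split=> // a an; case: na; exists a.
  have [b lP'] := partial_iso_forth mu_sym nu_sym a nu_ext lP.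
  exists ((a, b) :: l); split=> // [p pl|a' a'n]; first by rewrite inE pl orbT.
  exists b; rewrite (_ : a' = a) ?mem_head //.
  by apply: eV_inj; rewrite ?inE // an.
have back l n : P l -> exists l', [/\ P l', {subset l <= l'} &
    forall b, eW b = n -> exists a, (a, b) \in l'].
  move=> lP; have [[b bn]|nb] := pselect (exists b, eW b = n); last first.
    by exists l; split=> // b bn; case: nb; exists b.
  have [a] := partial_iso_forth nu_sym mu_sym b mu_ext (partial_iso_swap lP).
  move=> /partial_iso_swap/=; rewrite -map_comp map_id_in; last by case.
  move=> lP'; exists ((a, b) :: l); split=> // [p pl|b' b'n]; first by rewrite inE pl orbT.
  exists a; rewrite (_ : b' = b) ?mem_head //.
  by apply: eW_inj; rewrite ?inE // bn.
(* Placing the premise [P x.1] under the existential makes the extension step total, so that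
   [choice] applies. *)
have /choice[g gP] (x : seq (V * W) * nat) : exists l', P x.1 -> [/\ P l', {subset x.1 <= l'},
    forall a, eV a = x.2 -> exists b, (a, b) \in l' &
    forall b, eW b = x.2 -> exists a, (a, b) \in l'].
  have [lP|nP] := pselect (P x.1); last by exists [::] => /nP.
  have [l1 [P1 s1 h1]] := forth _ x.2 lP; have [l2 [P2 s2 h2]] := back _ x.2 P1.
  exists l2 => _; split=> // [p /s1/s2//|a /h1[b /s2 abl]]; by exists b.
(* Stage [n] takes care of the elements numbered [n] on both sides. *)
pose c := fix c n := if n is n'.+1 then g (c n', n') else [::].
have cP n : P (c n) by elim: n => [|n /(gP (_, n))[]].
have cS n : {subset c n <= c n.+1} by have [] := gP (c n, n) (cP n).
have cD n k : {subset c n <= c (k + n)%N}.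
  by elim: k => // k IH p /IH; exact: cS.
(* Two pairs of the chain always lie in a common stage. *)
have cc p q n m : p \in c n -> q \in c m ->
    (p.1 == q.1) = (p.2 == q.2) /\ (p.1 != q.1 -> mu p.1 q.1 = nu p.2 q.2).
  move=> /(cD _ m) pc /(cD _ n); rewrite addnC => qc; exact: (cP _ _ _ pc qc).
have /choice[phi phiP] a : exists b, exists n, (a, b) \in c n.
  have [_ _ h _] := gP (c (eV a), eV a) (cP _).
  by have [b abc] := h a erefl; exists b, (eV a).+1.
have /choice[psi psiP] b : exists a, exists n, (a, b) \in c n.
  have [_ _ _ h] := gP (c (eW b), eW b) (cP _).
  by have [a abc] := h b erefl; exists a, (eW b).+1.
have phi_eq a a' : (a == a') = (phi a == phi a').
  by have [n an] := phiP a; have [n' an'] := phiP a'; have [] := cc _ _ _ _ an an'.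
exists phi.
  exists psi => [a|b].
    have [n an] := phiP a; have [m bm] := psiP (phi a).
    by have [] := cc _ _ _ _ bm an; rewrite /= eqxx => /eqP.
  have [n an] := psiP b; have [m bm] := phiP (psi b).
  by have [] := cc _ _ _ _ bm an; rewrite /= eqxx => /esym/eqP.
move=> j u v; rewrite muP nuP -phi_eq.
have [n an] := phiP u; have [m bm] := phiP v; have [_ /= h] := cc _ _ _ _ an bm.
by split=> -[uv]; rewrite h.
Qed.

(** Classical logic equips arbitrary carriers with an equality test. *)
Lemma Rado_unique (V W : Type) (E : mstruct V) (F : mstruct W) :
  Rado_multigraph E -> Rado_multigraph F -> miso E F.
Proof. exact: (@Rado_unique_eqType {classic V} {classic W}). Qed.

(** * Words of independent letters *)

Fixpoint words (T : Type) (A : seq T) (m : nat) : seq (seq T) :=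
  if m is m'.+1 then [seq j :: s | j <- A, s <- words A m'] else [:: [::]].

Lemma mem_words (T : eqType) (A : seq T) m x :
  (x \in words A m) = (size x == m) && all [in A] x.
Proof.
elim: m x => [|m IH] [|j x] //=; first by apply/allpairsP => -[[? ?] []].
apply/allpairsP/andP => [[[j' x'] /= [jA]]|[sx /andP[jA xA]]].
  by rewrite IH => /andP[sx xA] [-> ->]; rewrite jA xA eqSS.
by exists (j, x); split; rewrite //= IH -eqSS sx.
Qed.

(* [wsum w A m phi] is the expectation of [phi] at a word of [m] independent
   letters, each being [j] in [A] with probability [w j]. *)
Definition wsum (R : pzRingType) (T : Type) (w : T -> R) (A : seq T) (m : nat)
    (phi : seq T -> R) : R :=
  \sum_(x <- words A m) (\prod_(j <- x) w j) * phi x.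

(** The required multiplicities are coded by a list, so that patterns can be concatenated together
    with words. *)
Definition hits (T : eqType) (U us x : seq T) : bool :=
  all (fun u => count_mem u x == count_mem u us) U.

Lemma hits_cat (T : eqType) (U us us' x x' : seq T) :
  hits U us x -> hits U us' x' -> hits U (us ++ us') (x ++ x').
Proof.
move=> /allP h /allP h'; apply/allP => u uU.
by rewrite !count_cat (eqP (h u uU)) (eqP (h' u uU)).
Qed.

Lemma hits_cons_notin (T : eqType) (U us x : seq T) j : j \notin U ->
  hits U us (j :: x) = hits U us x.
Proof.
move=> jU; apply: eq_in_all => u uU /=.
by have [ju|//] := eqVneq j u; rewrite ju uU in jU.
Qed.

Lemma hits_cons_in (T : eqType) (U us x : seq T) j :
  hits U (j :: us) (j :: x) = hits U us x.
Proof. by apply: eq_in_all => u uU /=; rewrite eqn_add2l. Qed.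

Section WordSums.
Variables (R : realFieldType) (T : eqType) (w : T -> R) (A : seq T).
Implicit Types (phi psi : seq T -> R) (m : nat).

Lemma wsum0 phi : wsum w A 0 phi = phi [::].
Proof. by rewrite /wsum big_seq1 big_nil mul1r. Qed.

Lemma wsumS m phi :
  wsum w A m.+1 phi = \sum_(j <- A) w j * wsum w A m (fun s => phi (j :: s)).
Proof.
rewrite /wsum big_allpairs_dep; apply: eq_bigr => j _.
by rewrite mulr_sumr; apply: eq_bigr => s _; rewrite big_cons mulrA.
Qed.

Lemma eq_wsum m phi psi : (forall x, x \in words A m -> phi x = psi x) ->
  wsum w A m phi = wsum w A m psi.
Proof. by move=> h; apply: eq_big_seq => x /h ->. Qed.

Lemma wsum_cat m n phi : wsum w A (m + n) phi =
  wsum w A m (fun s => wsum w A n (fun s' => phi (s ++ s'))).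
Proof.
elim: m phi => [|m IH] phi; first by rewrite wsum0.
by rewrite addSn !wsumS; apply: eq_bigr => j _; rewrite IH.
Qed.

Lemma wsumZ m c phi : wsum w A m (fun x => c * phi x) = c * wsum w A m phi.
Proof. by rewrite /wsum mulr_sumr; apply: eq_bigr => x _; rewrite mulrCA. Qed.

Lemma wsumB m phi psi :
  wsum w A m (fun x => phi x - psi x) = wsum w A m phi - wsum w A m psi.
Proof. by rewrite /wsum -sumrB; apply: eq_bigr => x _; rewrite mulrBr. Qed.

Hypothesis w_ge0 : forall j, j \in A -> 0 <= w j.

Lemma le_wsum m phi psi : (forall x, x \in words A m -> phi x <= psi x) ->
  wsum w A m phi <= wsum w A m psi.
Proof.
move=> h; rewrite /wsum big_seq [leRHS]big_seq; apply: ler_sum => x xw.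
apply: ler_wpM2l; last exact: h.
move: xw; rewrite mem_words => /andP[_ /allP xA].
by rewrite big_seq; apply: prodr_ge0 => j /xA /w_ge0.
Qed.

Hypothesis w_sum : \sum_(j <- A) w j = 1.

Lemma wsum_cst m c : wsum w A m (fun=> c) = c.
Proof.
elim: m => [|m IH]; first by rewrite wsum0.
rewrite wsumS (eq_bigr (fun j => w j * c)) => [|j _]; last by rewrite IH.
by rewrite -mulr_suml w_sum mul1r.
Qed.

Hypothesis A_uniq : uniq A.

(* First and second factorial moments of the binomial law. *)
Lemma wsum_count_quadratic m u (a b c : R) : u \in A ->
  wsum w A m (fun x => let n := (count_mem u x)%:R in a + b * n + c * (n * (n - 1)))
  = a + b * (m%:R * w u) + c * (m%:R * (m%:R - 1) * w u ^+ 2).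
Proof.
move=> uA; elim: m a b c => [|m IH] a b c; first by rewrite wsum0 /=; ring.
rewrite wsumS (bigD1_seq u) //=.
rewrite (eq_bigr (fun j => w j *
    (a + b * (m%:R * w u) + c * (m%:R * (m%:R - 1) * w u ^+ 2)))); last first.
  move=> j ju; congr (_ * _); rewrite -IH; apply: eq_wsum => x _ /=.
  by rewrite (negbTE ju).
rewrite -mulr_suml.
have -> : \sum_(j <- A | j != u) w j = 1 - w u.
  by rewrite -w_sum [X in _ = X - _](bigD1_seq u) //= [RHS]addrC addKr.
rewrite (_ : wsum _ _ _ _ =
    a + b + (b + 2 * c) * (m%:R * w u) + c * (m%:R * (m%:R - 1) * w u ^+ 2)).
  by rewrite -(natr1 m); ring.
rewrite -IH; apply: eq_wsum => x _ /=; rewrite eqxx natrD (_ : nat_of_bool true = 1%N) //; ring.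
Qed.

Section Hits.
Variable U : seq T.
Let q : R := \sum_(j <- A | j \notin U) w j.

Let q_ge0 : 0 <= q.
Proof. by rewrite /q big_seq_cond; apply: sumr_ge0 => j /andP[/w_ge0]. Qed.

Let q_le1 : q <= 1.
Proof.
rewrite -w_sum [leRHS](bigID (fun j => j \in U)) /= lerDr.
by rewrite big_seq_cond; apply: sumr_ge0 => j /andP[/w_ge0].
Qed.

Lemma wsum_hits0 m : q ^+ m <= wsum w A m (fun x => (hits U [::] x)%:R).
Proof.
elim: m => [|m IH].
  by rewrite wsum0 expr0 /hits (eq_all (a2 := predT)) // all_predT.
rewrite wsumS (bigID (fun j => j \in U)) /=; apply: ler_wpDl.
  rewrite big_seq_cond; apply: sumr_ge0 => j /andP[/w_ge0 wj _].
  apply: mulr_ge0 => //; rewrite -(wsum_cst m 0).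
  by apply: le_wsum => x _; rewrite ler0n.
rewrite exprS mulr_suml [leRHS]big_seq_cond [leLHS]big_seq_cond.
apply: ler_sum => j /andP[/w_ge0 wj jU].
apply: ler_wpM2l => //; apply: le_trans IH _; apply: le_wsum => x _.
by rewrite hits_cons_notin.
Qed.

(** Choose the place of [u] and let the other letters avoid [U]. This gives the exponent [m - 1],
    weakened to [m] so as to include [m = 0]. *)
Lemma wsum_hits1 m u : u \in A -> u \in U ->
  m%:R * w u * q ^+ m <= wsum w A m (fun x => (hits U [:: u] x)%:R).
Proof.
move=> uA uU; have wu := w_ge0 uA.
suff h n : n.+1%:R * w u * q ^+ n <= wsum w A n.+1 (fun x => (hits U [:: u] x)%:R).
  case: m => [|m]; last first.
    apply: le_trans (h m); apply: ler_wpM2l; first by rewrite mulr_ge0.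
    by rewrite exprS ler_piMl // exprn_ge0.
  by rewrite !mul0r wsum0 ler0n.
(* Split on the first letter: either it avoids [U], or it is [u] and the rest avoids [U]. *)
have step k : q * wsum w A k (fun x => (hits U [:: u] x)%:R) + w u * q ^+ k <=
    wsum w A k.+1 (fun x => (hits U [:: u] x)%:R).
  rewrite wsumS (bigID (fun j => j \in U)) /= [leRHS]addrC; apply: lerD; last first.
    rewrite big_mkcond /= (bigD1_seq u) //= uU; apply: ler_wpDr.
      rewrite big_seq_cond; apply: sumr_ge0 => j /andP[/w_ge0 wj _].
      case: ifP => // _; apply: mulr_ge0 => //; rewrite -(wsum_cst k 0).
      by apply: le_wsum => x _; rewrite ler0n.
    apply: ler_wpM2l => //; apply: le_trans (wsum_hits0 _) _.
    by apply: le_wsum => x _; rewrite hits_cons_in.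
  rewrite mulr_suml [leRHS]big_seq_cond [leLHS]big_seq_cond.
  apply: ler_sum => j /andP[/w_ge0 wj jU]; apply: ler_wpM2l => //.
  by apply: le_wsum => x _; rewrite hits_cons_notin.
elim: n => [|n IH]; last first.
  apply: le_trans (step _); rewrite -(natr1 n.+1) mulrDl mulrDl mul1r lerD2r.
  by rewrite exprS mulrCA ler_wpM2l.
apply: le_trans (step 0%N); rewrite expr0 !mulr1 mul1r lerDr wsum0.
by rewrite mulr_ge0 // ler0n.
Qed.

(* The word is cut into [size us] blocks of length [L] and a rest; it is enough
   that the [k]-th block meets [U] exactly once, in the [k]-th letter of [us],
   and that the rest avoids [U]. *)
Lemma wsum_hits us L c : {subset us <= A} -> {subset us <= U} ->
  (\prod_(u <- us) (L%:R * w u)) * q ^+ (size us * L + c) <=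
  wsum w A (size us * L + c) (fun x => (hits U us x)%:R).
Proof.
elim: us => [|u us IH] usA usU.
  by rewrite big_nil mul1r mul0n add0n wsum_hits0.
have uA : u \in A by rewrite usA ?mem_head.
have uU : u \in U by rewrite usU ?mem_head.
have {}IH := IH (fun x xs => usA x (mem_behead (s := u :: us) xs))
  (fun x xs => usU x (mem_behead (s := u :: us) xs)).
rewrite /= mulSn -addnA wsum_cat big_cons exprD mulrACA.
set W := wsum w A (_ + c) _ in IH.
apply: le_trans (_ : wsum w A L (fun x => (hits U [:: u] x)%:R) * W <= _).
  apply: ler_pM; rewrite ?wsum_hits1 //.
    by rewrite !mulr_ge0 ?exprn_ge0 ?ler0n ?w_ge0.
  apply: mulr_ge0; last exact: exprn_ge0.
  rewrite big_seq; apply: prodr_ge0 => v vus.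
  by rewrite mulr_ge0 ?ler0n ?w_ge0 // usA // inE vus orbT.
rewrite mulrC -wsumZ; apply: le_wsum => x _; rewrite mulrC /W -wsumZ.
apply: le_wsum => x' _; rewrite -natrM ler_nat.
case hx : (hits U [:: u] x) => //=; case hx' : (hits U us x') => //=.
by rewrite mul1n lt0b; apply: (hits_cat hx hx').
Qed.

End Hits.
End WordSums.

(** * A test function for small degrees *)

(* [gamma_ratio d] is [Gamma (d - 1/2) / Gamma d] up to a constant: it is an
   exact eigenfunction, of order [d ^ (-1/2)], of [g |-> d (g (d + 1) - g d)].
   The value [1] at [d = 0] is junk. *)
Fixpoint gamma_ratio (R : fieldType) (d : nat) : R :=
  if d is d'.+1 then
    if d' is 0%N then 1 else gamma_ratio R d' * (1 - (2 * d'%:R)^-1)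
  else 1.

Section GammaRatio.
Variable (R : realFieldType).
Local Notation g := (gamma_ratio R).

Lemma gamma_ratioS d : (0 < d)%N -> g d.+1 = g d * (1 - (2 * d%:R)^-1).
Proof. by case: d. Qed.

Lemma gamma_ratio_gt0 d : 0 < g d.
Proof.
elim: d => [|[|d] IH]; rewrite ?ltr01 // gamma_ratioS // mulr_gt0 //.
rewrite subr_gt0 invf_lt1 ?mulr_gt0 ?ltr0n //.
by rewrite -natrM (ltr_nat R 1); lia.
Qed.

(** Newton's forward expansion of [g] at [d], stopped after the second difference
    [3 g(d) / (4 d (d + 1))]; complete monotonicity makes the third difference nonpositive. *)
Lemma gamma_ratio_add d n : (0 < d)%N -> g (d + n) <=
  g d + (- (g d * (2 * d%:R)^-1)) * n%:R
  + g d * (3 / 8 / (d%:R * (d%:R + 1))) * (n%:R * (n%:R - 1)).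
Proof.
move=> d0; have D0 : 0 < d%:R :> R by rewrite ltr0n.
suff h : g (d + n) <= g d *
    (1 - n%:R / (2 * d%:R) + 3 / 8 / (d%:R * (d%:R + 1)) * (n%:R * (n%:R - 1))).
  by apply: le_trans h _; rewrite le_eqVlt; apply/orP; left; apply/eqP; ring.
elim: n => [|n IH]; first by rewrite addn0 !mul0r mulr0 subr0 addr0 mulr1.
rewrite addnS gamma_ratioS ?addn_gt0 ?d0 //.
have N0 : 0 <= n%:R :> R by rewrite ler0n.
have s0 : 0 <= 1 - (2 * (d + n)%:R)^-1 :> R.
  rewrite subr_ge0 invf_le1 ?mulr_gt0 ?ltr0n ?addn_gt0 ?d0 //.
  by rewrite -natrM (ler_nat R 1); lia.
apply: le_trans (ler_wpM2r s0 IH) _.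
rewrite -[leLHS]mulrA ler_pM2l ?gamma_ratio_gt0 //.
have NN : 0 <= n%:R * (n%:R - 1) :> R.
  case: n N0 {IH s0} => [|n] _; first by rewrite mul0r.
  by rewrite mulr_ge0 ?ler0n // subr_ge0 (ler_nat R 1).
rewrite -subr_ge0 natrD -natr1.
set D := d%:R in D0 *; set N := n%:R in N0 NN *.
(* Up to the factor [g d], the bound at [n] times the next factor of the recursion falls short of
   the bound at [n + 1] by this nonnegative amount. *)
rewrite [leRHS](_ : _ = 15 / 16 * (N * (N - 1)) / (D * (D + 1) * (D + N))).
  apply: divr_ge0; first by rewrite mulr_ge0 //; lra.
  by rewrite !mulr_ge0 //; lra.
by field; apply/and3P; split; rewrite gt_eqF //; lra.
Qed.

(** The product is [1] at [d = 1] and nondecreasing: [(1 - 1 / (2 d)) ^ 2 (4 d + 1)] exceeds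
    [4 d - 3] by exactly [1 / (4 d ^ 2)]. *)
Lemma gamma_ratio_sqr_ge d : (0 < d)%N -> 1 <= g d ^+ 2 * (4 * d%:R - 3).
Proof.
elim: d => // -[|d] IH _; first by rewrite /= expr1n; lra.
apply: le_trans (IH isT) _; rewrite (gamma_ratioS (d := d.+1)) // exprMn -[leRHS]mulrA.
rewrite ler_pM2l ?exprn_gt0 ?gamma_ratio_gt0 // -(natr1 d.+1).
have : 1 <= d.+1%:R :> R by rewrite (ler_nat R 1).
set D := d.+1%:R => D1; rewrite -subr_ge0.
rewrite [leRHS](_ : _ = (4 * D ^+ 2)^-1); first by rewrite invr_ge0 mulr_ge0 ?sqr_ge0.
by field; rewrite gt_eqF //; lra.
Qed.

End GammaRatio.

(** * Histories of the process *)

Definition update (h : nat -> nat -> nat) (t : nat) (x : seq nat) :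
    nat -> nat -> nat :=
  fun s i => if s == t then nth 0%N x i else h s i.

Definition agree (v' : nat) (f : nat -> nat) (t : nat) (h h' : nat -> nat -> nat) :=
  forall s i, (v' <= s < t)%N -> (i < f s)%N -> h s i = h' s i.

(** One representative of each possible run up to time [t], zero at the entries that are not drawn;
    being finitely many, they turn expectations into finite sums. *)
Fixpoint histories (v' : nat) (f : nat -> nat) (t : nat) : seq (nat -> nat -> nat) :=
  if t is s.+1 then
    if (v' <= s)%N then
      [seq update h s x | h <- histories v' f s, x <- words (iota 1 s) (f s)]
    else [:: fun _ _ => 0%N]
  else [:: fun _ _ => 0%N].

Lemma words_uniq (T : eqType) (A : seq T) m : uniq A -> uniq (words A m).
Proof.
move=> uA; elim: m => // m IH /=; apply: allpairs_uniq => //.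
by move=> [a x] [b y] _ _ /= [-> ->].
Qed.

Section Histories.
Variables (v' : nat) (E' : dmultigraph) (f : nat -> nat).
Implicit Types (h : nat -> nat -> nat) (t : nat).
Local Notation G h t := (MPA_graph v' E' f h t).

Lemma agree_update h t x : agree v' f t (update h t x) h.
Proof. by move=> s i /andP[_ st] _; rewrite /update ltn_eqF. Qed.

Lemma mkseq_update h t x : size x = f t -> mkseq (update h t x t) (f t) = x.
Proof.
move=> <-; rewrite -[RHS](mkseq_nth 0%N).
by apply: eq_mkseq => i; rewrite /update eqxx.
Qed.

Lemma MPA_graph_initial h t : (t <= v')%N -> G h t = E'.
Proof. by case: t => // t; rewrite ltnNge /= => /negbTE ->. Qed.

Lemma MPA_graphS h t : (v' <= t)%N ->
  G h t.+1 = G h t ++ [seq (t.+1, y) | y <- mkseq (h t) (f t)].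
Proof. by move=> /= ->; rewrite -map_comp. Qed.

Lemma MPA_graph_agree h h' t : agree v' f t h h' -> G h t = G h' t.
Proof.
elim: t => // t IH hh; have [vt|vt] := leqP v' t; last by rewrite !MPA_graph_initial.
rewrite !MPA_graphS // IH; last first.
  by move=> s i /andP[vs st]; apply: hh; rewrite vs ltnW.
congr (_ ++ map _ _); apply/eq_in_map => i; rewrite mem_iota add0n => /= ift.
by apply: hh; rewrite ?vt /=.
Qed.

Lemma histories_valid h t s i : h \in histories v' f t ->
  (v' <= s < t)%N -> (i < f s)%N -> (1 <= h s i <= s)%N.
Proof.
elim: t h => [|t IH] h; first by rewrite ltn0 andbF.
rewrite ltnS /=; case: (leqP v' t) => [vt|tv] /=; last first.
  by move=> _ /andP[vs st]; have := leq_trans vs st; rewrite leqNgt tv.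
move=> /allpairsP[[h' x] /= [h't]]; rewrite mem_words => /andP[/eqP sx /allP xA ->].
move=> /andP[vs]; rewrite leq_eqVlt => /predU1P[-> ift|st]; last first.
  by rewrite /update (ltn_eqF st); apply: IH; rewrite ?vs.
rewrite /update eqxx.
have /xA : nth 0%N x i \in x by rewrite mem_nth // sx.
by rewrite mem_iota; lia.
Qed.

Section Valid.
Variables (h : nat -> nat -> nat) (t : nat).
Hypothesis E'_on : dmultigraph_on v' E'.
Hypothesis h_valid : forall s i, (v' <= s < t)%N -> (i < f s)%N -> (1 <= h s i <= s)%N.

Lemma MPA_graph_on s : (v' <= s <= t)%N -> dmultigraph_on s (G h s).
Proof.
elim: s => [|s IH] /andP[vs st].
  by rewrite MPA_graph_initial //; move: E'_on; rewrite (eqP (_ : v' == 0)%N) // -leqn0.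
move: vs; rewrite leq_eqVlt => /predU1P[vs|vs].
  by rewrite MPA_graph_initial -vs.
rewrite MPA_graphS // => e; rewrite mem_cat => /orP[/IH|/mapP[y /mapP[i]]].
  by rewrite ltnS in vs; rewrite vs (ltnW st) => /(_ isT); lia.
rewrite mem_iota add0n => /= ift -> ->.
by have := @h_valid s i; rewrite -ltnS vs st ift => /(_ isT isT) /=; lia.
Qed.

End Valid.
End Histories.

(** The handshake identity, which normalises the end-point probabilities. *)
Lemma sum_degree (E : dmultigraph) n : dmultigraph_on n E ->
  (\sum_(u <- iota 1 n) degree E u = 2 * size E)%N.
Proof.
elim: E => [|e E IH] Eon.
  by rewrite big1 // => u _; rewrite /degree.
rewrite /= (eq_bigr (fun u => ((e.1 == u) + (e.2 == u)) + degree E u)%N); last first.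
  by move=> u _; rewrite /degree /=; lia.
rewrite big_split /= IH; last by move=> e' e'E; apply: Eon; rewrite inE e'E orbT.
have sum1 a : (1 <= a <= n)%N -> (\sum_(u <- iota 1 n) (a == u) = 1)%N.
  move=> an; have ai : a \in iota 1 n by rewrite mem_iota; lia.
  rewrite (bigD1_seq a) ?iota_uniq //=.
  by rewrite eqxx big1 // => u ua; rewrite eq_sym (negbTE ua).
by have /andP[e1 e2] := Eon e (mem_head _ _); rewrite big_split /= !sum1 //; lia.
Qed.

Lemma degree_cat (E E1 : dmultigraph) u :
  degree (E ++ E1) u = (degree E u + degree E1 u)%N.
Proof. by rewrite /degree !count_cat addnACA. Qed.

Lemma degree_star a (x : seq nat) u : u != a ->
  degree [seq (a, y) | y <- x] u = count_mem u x.
Proof.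
move=> ua; rewrite /degree !count_map /=.
rewrite (eq_count (a2 := pred0)) ?count_pred0 ?add0n //.
by move=> y /=; rewrite eq_sym (negbTE ua).
Qed.

(** * Expectations as finite sums over histories *)

Section Expectation.
Variables (R : realType) (d : measure_display) (T : measurableType d).
Variables (P : probability T R) (v' : nat) (E' : dmultigraph) (f : nat -> nat).
Variable X : nat -> nat -> {RV P >-> nat}.
Implicit Types (h : nat -> nat -> nat) (t : nat) (w : T).
Local Notation G h t := (MPA_graph v' E' f h t).
Local Notation hist := (MPA_history v' f X).
Local Notation path w := (fun s i => X s i w).

(** For a functional that depends on the path only up to time [t], this finite sum is its mean. *)
Definition expect t (phi : (nat -> nat -> nat) -> R) : R :=
  \sum_(h <- histories v' f t) fine (P (hist h t)) * phi h.

Definition endpoint_prob h t j : R := (degree (G h t) j)%:R / (2 * cumul f t)%:R.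

Lemma measurable_X s i k : measurable [set w | X s i w = k].
Proof.
rewrite (_ : [set w | _] = X s i @^-1` [set k]) //.
exact: measurable_funPTI.
Qed.

Lemma measurable_history h t : measurable (hist h t).
Proof.
rewrite (_ : hist h t = \bigcap_s \bigcap_i
    [set w | (v' <= s < t)%N -> (i < f s)%N -> X s i w = h s i]); last first.
  by apply/seteqP; split=> w H s // => [_ i _|i]; apply: H.
apply: bigcap_measurable => // s _; apply: bigcap_measurable => // i _.
have [c|c] := boolP (v' <= s < t)%N; last first.
  by rewrite (_ : [set w | _] = setT) //; apply/seteqP; split.
have [c'|c'] := boolP (i < f s)%N; last first.
  by rewrite (_ : [set w | _] = setT) //; apply/seteqP; split.
rewrite (_ : [set w | _] = [set w | X s i w = h s i]); first exact: measurable_X.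
by apply/seteqP; split=> w /= H; [exact: H|].
Qed.

Lemma measurable_row t m x : measurable [set w | mkseq (X t ^~ w) m = x].
Proof.
have [sx|sx] := eqVneq (size x) m; last first.
  rewrite (_ : [set w | _] = set0) //; apply/seteqP; split=> // w /= e.
  by rewrite -e size_mkseq eqxx in sx.
rewrite (_ : [set w | _] = \bigcap_i [set w | (i < m)%N -> X t i w = nth 0%N x i]).
  apply: bigcap_measurable => // i _; have [c|c] := boolP (i < m)%N; last first.
    by rewrite (_ : [set w | _] = setT) //; apply/seteqP; split.
  rewrite (_ : [set w | _] = [set w | X t i w = nth 0%N x i]); first exact: measurable_X.
  by apply/seteqP; split=> w /= H; [exact: H|].
apply/seteqP; split=> [w /= <- i _ im|w H /=]; first by rewrite nth_mkseq.
by apply: (@eq_from_nth _ 0%N) => [|i]; rewrite size_mkseq // => im; rewrite nth_mkseq // H.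
Qed.

Lemma history_update h t x : (v' <= t)%N -> size x = f t ->
  hist (update h t x) t.+1 = hist h t `&` [set w | mkseq (X t ^~ w) (f t) = x].
Proof.
move=> vt sx; apply/seteqP; split=> [w H|w [H1 H2] s i] /=.
  split=> [s i st ift|].
    rewrite (H s i) //; last by move/andP: st => [-> /ltnW]; rewrite ltnS.
    exact: (@agree_update v' f).
  apply: (@eq_from_nth _ 0%N) => [|i]; rewrite size_mkseq // => ift.
  by rewrite nth_mkseq // (H t i) ?vt //= /update eqxx.
move=> /andP[vs]; rewrite ltnS leq_eqVlt => /predU1P[-> ift|st ifs].
  by rewrite /update eqxx -H2 nth_mkseq.
by rewrite H1 ?vs // /update ltn_eqF.
Qed.

Lemma measure_partition (S : choiceType) (Y : T -> S) (A : set T) (s : seq S) :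
  measurable A -> (forall x, measurable [set w | Y w = x]) -> uniq s ->
  P (A `&` [set w | Y w \in s]) = (\sum_(x <- s) P (A `&` [set w | Y w = x]))%E.
Proof.
move=> mA mY; elim: s => [|x s IH] /=.
  by rewrite big_nil (_ : [set w | _] = set0) ?setI0 ?measure0 //; apply/seteqP; split.
move=> /andP[xs us]; rewrite big_cons -IH //.
have mI (r : seq S) : measurable [set w | Y w \in r].
  elim: r => [|y r mr]; first by rewrite (_ : [set w | _] = set0) //; apply/seteqP; split.
  rewrite (_ : [set w | _] = [set w | Y w = y] `|` [set w | Y w \in r]); first exact: measurableU.
  apply/seteqP; split=> w /=; rewrite inE; first by case/predU1P; [left|right].
  by case=> [->|->]; rewrite ?eqxx ?orbT.
rewrite -measureU; try exact: measurableI.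
  rewrite -setIUr; congr (P (_ `&` _)); apply/seteqP; split=> w /=; rewrite inE.
    by case/predU1P; [left|right].
  by case=> [->|->]; rewrite ?eqxx ?orbT.
apply/seteqP; split=> // w /= [[_ Yx] [_ Ys]]; by rewrite -Yx Ys in xs.
Qed.

Hypothesis X_range : forall t i w, (v' <= t)%N -> (i < f t)%N -> (1 <= X t i w <= t)%N.

Lemma row_in_words t w : (v' <= t)%N ->
  mkseq (X t ^~ w) (f t) \in words (iota 1 t) (f t).
Proof.
move=> vt; rewrite mem_words size_mkseq eqxx; apply/allP => y /mapP[i].
rewrite mem_iota add0n => /= ift ->; change (X t i w \in iota 1 t); rewrite mem_iota.
by have := X_range w vt ift; lia.
Qed.

Lemma prob_histories t (A : set T) : measurable A ->
  P A = (\sum_(h <- histories v' f t) P (A `&` hist h t))%E.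
Proof.
move=> mA; have triv s : (s <= v')%N ->
    P A = (\sum_(h <- [:: (fun _ _ => 0%N)]) P (A `&` hist h s))%E.
  move=> sv; rewrite big_seq1 (_ : hist _ s = setT) ?setIT //.
  by apply/seteqP; split=> // w _ s' i; lia.
elim: t => [|t IH]; first exact: triv.
rewrite /=; case: ifPn => [vt|]; last by rewrite -ltnNge; exact: triv.
rewrite big_allpairs_dep IH; apply: eq_bigr => h _.
(* By the range condition the new row is surely one of the words, so the event splits according to
   its value. *)
rewrite -[A `&` _]setIT -(_ : [set w | mkseq (X t ^~ w) (f t) \in words (iota 1 t) (f t)] = setT).
  rewrite measure_partition; first last.
  - exact/words_uniq/iota_uniq.
  - exact: measurable_row.
  - by apply: measurableI => //; exact: measurable_history.
  rewrite big_seq [RHS]big_seq; apply: eq_bigr => x; rewrite mem_words => /andP[/eqP sx _].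
  by rewrite history_update // setIA.
by apply/seteqP; split=> // w _; exact: row_in_words.
Qed.

Lemma history_cover t w : exists2 h, h \in histories v' f t & hist h t w.
Proof.
elim: t => [|s [h hs hw]].
  by exists (fun _ _ => 0%N) => [|s i]; rewrite ?mem_head // ltn0 andbF.
rewrite /=; case: ifPn => [vs|]; last first.
  rewrite -ltnNge => sv; exists (fun _ _ => 0%N); rewrite ?mem_head // => s' i; lia.
exists (update h s (mkseq (X s ^~ w) (f s))).
  by apply: allpairs_f => //; exact: row_in_words.
by rewrite history_update ?size_mkseq.
Qed.

Section Event.
Variables (t : nat) (Q : (nat -> nat -> nat) -> bool).
Hypothesis Q_agree : forall h h', agree v' f t h h' -> Q h = Q h'.

Lemma measurable_history_event : measurable [set w | Q (path w)].
Proof.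
rewrite (_ : [set w | _] =
    \bigcup_(h in [set h | h \in histories v' f t /\ Q h]) hist h t).
  apply: fin_bigcup_measurable => [|h _]; last exact: measurable_history.
  apply: sub_finite_set (finite_seq (histories v' f t)) => h /= [] //.
apply/seteqP; split=> [w /= Qw|w [h [_ Qh] hw]] /=; last by rewrite (Q_agree hw).
have [h ht hw] := history_cover t w; exists h => //; split=> //.
by rewrite -(Q_agree hw).
Qed.

Lemma prob_history_event : P [set w | Q (path w)] = (expect t (fun h => (Q h)%:R))%:E.
Proof.
rewrite (prob_histories t measurable_history_event) /expect -sumEFin.
apply: eq_bigr => h _; case Qh: (Q h).
  rewrite mulr1 fineK ?fin_num_measure //; last exact: measurable_history.
  congr (P _); apply/seteqP; split=> [w []//|w hw]; split=> //=.
  by rewrite (Q_agree hw).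
rewrite mulr0 (_ : _ `&` _ = set0) ?measure0 //; apply/seteqP; split=> // w /= [Qw hw].
by rewrite (Q_agree hw) Qh in Qw.
Qed.

End Event.

Lemma expect_cst t c : expect t (fun=> c) = c.
Proof.
have := @prob_history_event t predT (fun _ _ _ => erefl).
rewrite (_ : [set w | _] = setT); last by apply/seteqP; split.
rewrite probability_setT => -[/esym e]; rewrite -[RHS]mulr1 -[in RHS]e /expect mulr_sumr.
by apply: eq_bigr => h _; rewrite mulr1 mulrC.
Qed.

Lemma le_expect t phi psi :
  (forall h, h \in histories v' f t -> phi h <= psi h) -> expect t phi <= expect t psi.
Proof.
move=> h; rewrite /expect big_seq [leRHS]big_seq; apply: ler_sum => k kt.
by apply: ler_wpM2l; [exact/fine_ge0/measure_ge0 | exact: h].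
Qed.

Lemma eq_expect t phi psi :
  (forall h, h \in histories v' f t -> phi h = psi h) -> expect t phi = expect t psi.
Proof. by move=> h; apply: eq_big_seq => k /h ->. Qed.

Lemma expectZ t c phi : expect t (fun h => c * phi h) = c * expect t phi.
Proof. by rewrite /expect mulr_sumr; apply: eq_bigr => h _; rewrite mulrCA. Qed.

Lemma expectD t phi psi :
  expect t (fun h => phi h + psi h) = expect t phi + expect t psi.
Proof. by rewrite /expect -big_split; apply: eq_bigr => h _; rewrite mulrDr. Qed.

Hypothesis X_MPA : is_MPA v' E' f X.

(** Conditioning on the past: given a history, row [t] consists of independent letters with the
    end-point probabilities of [G(t)]. *)
Lemma expectS t phi : (v' <= t)%N -> expect t.+1 phi =
  expect t (fun h => wsum (endpoint_prob h t) (iota 1 t) (f t)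
                          (fun x => phi (update h t x))).
Proof.
move=> vt; rewrite /expect [in LHS]/= vt big_allpairs_dep; apply: eq_bigr => h _.
rewrite /wsum mulr_sumr big_seq [RHS]big_seq; apply: eq_bigr => x.
rewrite mem_words => /andP[/eqP sx _]; rewrite mulrA; congr (_ * _).
have [_ /(_ t (update h t x) vt) ->] := X_MPA.
have -> : hist (update h t x) t = hist h t.
  apply/seteqP; split=> w H s i st ifs; rewrite H //.
    exact: (agree_update h x st ifs).
  exact/esym/(agree_update h x st ifs).
rewrite (MPA_graph_agree E' (@agree_update v' f h t x)).
rewrite fineM ?fin_num_measure //; last exact: measurable_history.
congr (_ * _); rewrite /= (big_nth 0%N) sx big_mkord; apply: eq_bigr => i _.
by rewrite /update eqxx.
Qed.

End Expectation.

(** * Growth estimates *)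

Lemma exists_nat_ge (R : realType) (x : R) : exists n : nat, x <= n%:R.
Proof.
exists (Num.bound `|x|); apply: le_trans (ler_norm x) _.
by apply: ltW; exact: archi_boundP.
Qed.

Lemma exists_upper_bound (s : seq nat) : exists n, all (geq n) s.
Proof.
by exists (\max_(i <- s) i)%N; apply/allP => i si; exact: leq_bigmax_seq.
Qed.

Lemma cumulS f t : cumul f t.+1 = (cumul f t + f t)%N.
Proof. by rewrite /cumul big_nat_recr. Qed.

Lemma cumul_quadratic (R : realType) f : Theta_linear R f ->
  exists c1 c2 a b : R, [/\ 0 < c1, 0 < c2, 0 < a & 0 < b] /\
    exists t1 : nat, forall t : nat, (t1 <= t)%N ->
      [/\ 1 <= t%:R :> R, c1 * t%:R <= (f t)%:R, (f t)%:R <= c2 * t%:R,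
          a * t%:R ^+ 2 <= (cumul f t)%:R & (cumul f t)%:R <= b * t%:R ^+ 2].
Proof.
move=> [c1 [c2 [c1_gt0 c12 [t0 ft]]]].
have c2_gt0 : 0 < c2 by exact: lt_le_trans c12.
(* The constant [b] absorbs the initial sum [F(t0)], as [t ^ 2 >= 1]. *)
exists c1, c2, (c1 / 4), (c2 + (cumul f t0)%:R); split.
  by split=> //; [rewrite divr_gt0|rewrite ltr_wpDr].
(* From [2 t0 + 4] on, [t ^ 2 - t - t0 ^ 2 >= t ^ 2 / 2], whence the constant [c1 / 4]. *)
exists (2 * t0 + 4)%N => t tt.
have t1 : (1 : R) <= t%:R by rewrite (ler_nat R 1); lia.
have t0t : (t0 <= t)%N by lia.
have /andP[f1 f2] := ft t t0t.
have lo s : (t0 <= s)%N -> c1 * (s%:R ^+ 2 - s%:R - t0%:R ^+ 2) <= 2 * (cumul f s)%:R.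
  move=> /subnK <-; elim: (s - t0)%N => [|k IH].
    rewrite add0n; apply: (@le_trans _ _ 0); last by rewrite mulr_ge0.
    by rewrite pmulr_rle0 // [_ - _ - _](_ : _ = - t0%:R) ?oppr_le0 //; ring.
  rewrite addSn cumulS natrD -(natr1 (k + t0)).
  have /andP[h _] := ft (k + t0)%N (leq_addl _ _); lra.
have hi s : (t0 <= s)%N -> (cumul f s)%:R <= (cumul f t0)%:R + c2 * s%:R ^+ 2.
  move=> /subnK <-; elim: (s - t0)%N => [|k IH].
    by rewrite add0n ler_wpDr // mulr_ge0 ?exprn_ge0 // ltW.
  rewrite addSn cumulS natrD -(natr1 (k + t0)).
  have /andP[_ h] := ft (k + t0)%N (leq_addl _ _).
  have k0 : 0 <= (k + t0)%:R :> R by [].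
  have : 0 <= c2 * (k + t0)%:R by rewrite mulr_ge0 // ltW.
  lra.
split=> //.
  have tt0 : 2 * t0%:R <= t%:R :> R by rewrite -natrM ler_nat; lia.
  have t4 : (4 : R) <= t%:R by rewrite (ler_nat R 4); lia.
  have t00 : 0 <= t0%:R :> R by [].
  have e : t%:R ^+ 2 / 2 <= t%:R ^+ 2 - t%:R - t0%:R ^+ 2 :> R by nra.
  have := ler_wpM2l (ltW c1_gt0) e; have := lo t t0t; lra.
apply: le_trans (hi t t0t) _; rewrite addrC mulrDl lerD2l.
by apply: ler_peMr => //; rewrite exprn_ege1.
Qed.

(* The invariant is [z t <= C (1 - 2 k / t)]. *)
Lemma bounded_of_summable_growth (R : realType) (z : nat -> R) (k : R) t0 :
  0 <= k -> (forall t, 0 <= z t) ->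
  (forall t, (t0 <= t)%N -> z t.+1 <= z t * (1 + k / t%:R ^+ 2)) ->
  exists C, exists2 t1, 0 <= C & forall t, (t1 <= t)%N -> z t <= C.
Proof.
move=> k_ge0 z_ge0 zS; have [n nk] := exists_nat_ge (4 * k).
pose t1 := (t0 + n + 1)%N; exists (2 * z t1), t1; first by rewrite mulr_ge0.
have pos t : (t1 <= t)%N -> 1 <= t%:R :> R /\ 4 * k <= t%:R.
  move=> tt; split; first by rewrite (ler_nat R 1); lia.
  by apply: le_trans nk _; rewrite ler_nat; lia.
suff inv t : (t1 <= t)%N -> z t <= 2 * z t1 * (1 - 2 * k / t%:R).
  move=> t tt; apply: le_trans (inv t tt) _; apply: ler_piMr; first by rewrite mulr_ge0.
  by have [? ?] := pos t tt; rewrite lerBlDr lerDl divr_ge0 ?mulr_ge0.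
move=> /subnK <-; elim: (t - t1)%N => [|j IH].
  rewrite add0n; have [t11 t1k] := pos t1 (leqnn _).
  rewrite mulrAC; apply: ler_peMl => //.
  have : 2 * k / t1%:R <= 1 / 2 by rewrite ler_pdivrMr; lra.
  lra.
rewrite addSn; set s := (j + t1)%N in IH *.
have [s1 sk] := pos s (leq_addl _ _).
have c_ge0 : 0 <= k / s%:R ^+ 2 by rewrite divr_ge0 // exprn_ge0.
apply: le_trans (zS s _) _; first by rewrite /s /t1; lia.
apply: le_trans (ler_wpM2r _ IH) _; first by lra.
rewrite -[leLHS]mulrA; apply: ler_wpM2l; first by rewrite mulr_ge0.
rewrite -(natr1 s); set S := s%:R in s1 sk c_ge0 *.
have S0 : 0 < S by lra.
have e : 1 - 2 * k / (S + 1) - (1 - 2 * k / S) = 2 * k / (S * (S + 1)).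
  by field; apply/andP; split; rewrite gt_eqF //; lra.
have e2 : k / S ^+ 2 <= 2 * k / (S * (S + 1)).
  rewrite ler_pdivlMr ?mulr_gt0 //; last lra.
  rewrite mulrAC ler_pdivrMr ?exprn_gt0 //.
  rewrite -subr_ge0 [leRHS](_ : _ = k * S * (S - 1)); last by ring.
  by rewrite !mulr_ge0 //; lra.
have e3 : 0 <= 2 * k / S * (k / S ^+ 2) by rewrite mulr_ge0 // divr_ge0 //; lra.
move: e e2 e3; set a := 2 * k / S; set b := 2 * k / (S + 1).
by set c := k / S ^+ 2; set e' := 2 * k / _; lra.
Qed.

(** The base is the second-order expansion of [(1 + r) ^ (-1/2)], and [1 + 2 r <= (1 + r) ^ 2]. The
    errors are controlled through its square, at most [1 - r + r ^ 2], and through [r <= 1/4]. *)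
Lemma quartic_contraction (R : realType) (r : R) : 0 <= r <= 1 / 4 ->
  (1 - r / 2 + 3 / 8 * r ^+ 2) ^+ 4 * (1 + 2 * r) <= 1.
Proof.
move=> /andP[r0 r1].
have r20 : 0 <= r ^+ 2 by rewrite sqr_ge0.
have s0 : 0 <= 1 - r / 2 + 3 / 8 * r ^+ 2 by lra.
have s1 : (1 - r / 2 + 3 / 8 * r ^+ 2) ^+ 2 <= 1 - r + r ^+ 2.
  rewrite -subr_ge0 [leRHS](_ : _ = r ^+ 2 * r * (3 / 8 - 9 / 64 * r)); last by field.
  by rewrite !mulr_ge0 //; lra.
have s2 : (1 - r / 2 + 3 / 8 * r ^+ 2) ^+ 4 <= (1 - r + r ^+ 2) ^+ 2.
  rewrite (exprM _ 2 2); apply: lerXn2r => //; rewrite nnegrE ?exprn_ge0 //; lra.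
apply: (@le_trans _ _ ((1 - r + r ^+ 2) ^+ 2 * (1 + 2 * r))).
  by apply: ler_wpM2r s2; lra.
rewrite -subr_ge0 [leRHS](_ : _ = r ^+ 2 * (1 - 4 * r + r ^+ 2 * (3 - 2 * r))); last by ring.
apply: mulr_ge0 => //; apply: addr_ge0; first by lra.
by apply: mulr_ge0 => //; lra.
Qed.

(** For such [y], [1 / (1 - y) <= 1 + 2 y <= exp (2 y)]. *)
Lemma exp_one_sub_ge (R : realType) (y : R) n : 0 <= y <= 1 / 2 ->
  expR (- (2 * y * n%:R)) <= (1 - y) ^+ n.
Proof.
move=> /andP[y0 y1]; rewrite -mulNr expRM_natr.
apply: lerXn2r; rewrite ?nnegrE ?expR_ge0 //; first by lra.
rewrite expRN -[leRHS]invrK lef_pV2 ?posrE ?expR_gt0 ?invr_gt0; last by lra.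
  apply: le_trans (expR_ge1Dx _).
  rewrite -[leLHS]mul1r ler_pdivrMr; last by lra.
  have : 0 <= y * (1 - 2 * y) by rewrite mulr_ge0 //; lra.
  lra.
by lra.
Qed.

(** * Tightness of the degrees *)

Section Tightness.
Variables (R : realType) (d : measure_display) (T : measurableType d).
Variables (P : probability T R) (v' : nat) (E' : dmultigraph) (f : nat -> nat).
Variable X : nat -> nat -> {RV P >-> nat}.
Implicit Types (h : nat -> nat -> nat) (t u : nat) (w : T).
Local Notation G h t := (MPA_graph v' E' f h t).
Local Notation path w := (fun s i => X s i w).
Local Notation expect := (expect v' f X).
Local Notation endpoint_prob := (endpoint_prob R v' E' f).
Local Notation deg u t := (fun h => (degree (G h t) u)%:R : R).

Hypothesis E'_on : dmultigraph_on v' E'.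
Hypothesis E'_no_isolated : no_isolated v' E'.
Hypothesis f0 : f 0%N = size E'.
Hypothesis f_eq0 : forall t, (1 <= t <= v' - 1)%N -> f t = 0%N.
Hypothesis f_ge1 : forall t, (v' <= t)%N -> (1 <= f t)%N.
Hypothesis f_linear : Theta_linear R f.
Hypothesis X_MPA : is_MPA v' E' f X.

Let X_range : forall t i w, (v' <= t)%N -> (i < f t)%N -> (1 <= X t i w <= t)%N.
Proof. by case: X_MPA. Qed.

Let E'_gt0 : (0 < size E')%N.
Proof.
(* If [v' = 0], the bound [f 0 >= 1] already provides an edge. *)
have [v0|v0] := posnP v'; first by rewrite -f0; apply: f_ge1; rewrite v0.
have [e] := E'_no_isolated (u := 1%N) v0; by case: E'.
Qed.

Let v'_gt0 : (0 < v')%N.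
Proof.
case: (posnP v') E'_gt0 => // v0.
by case: E' E'_on => // e E /(_ e (mem_head _ _)); rewrite v0; lia.
Qed.

Lemma cumul_initial : cumul f v' = size E'.
Proof.
rewrite /cumul big_ltn // f0 big_nat big1 ?addn0 // => t tv; apply: f_eq0; lia.
Qed.

Lemma size_MPA_graph h t : (v' <= t)%N -> size (G h t) = cumul f t.
Proof.
move=> /subnK <-; elim: (t - v')%N => [|k IH].
  by rewrite add0n MPA_graph_initial // cumul_initial.
by rewrite addSn MPA_graphS ?leq_addl // size_cat IH size_map size_mkseq cumulS.
Qed.

Lemma cumul_gt0 t : (v' <= t)%N -> (0 < cumul f t)%N.
Proof.
move=> /subnK <-; elim: (t - v')%N => [|k IH]; first by rewrite add0n cumul_initial.
by rewrite addSn cumulS addn_gt0 IH.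
Qed.

Let two_cumul_gt0 t : (v' <= t)%N -> 0 < (2 * cumul f t)%:R :> R.
Proof. by move=> vt; rewrite ltr0n muln_gt0 cumul_gt0. Qed.

Lemma degree_MPA_graph_gt0 h t u : (v' <= t)%N -> (1 <= u <= t)%N ->
  (0 < degree (G h t) u)%N.
Proof.
move=> /subnK <-; elim: (t - v')%N => [|k IH].
  rewrite add0n MPA_graph_initial // => uv; have [e eE] := E'_no_isolated uv.
  move=> /orP[eu|eu]; rewrite addn_gt0 -!has_count; apply/orP; [left|right];
    by apply/hasP; exists e.
rewrite addSn MPA_graphS ?leq_addl // degree_cat => /andP[u1].
rewrite leq_eqVlt => /predU1P[->|uk]; last by rewrite addn_gt0 IH // u1.
rewrite !addn_gt0 -!has_count; apply/orP; right; apply/orP; left.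
have fk : (0 < f (k + v'))%N by apply: f_ge1; rewrite leq_addl.
apply/hasP; exists ((k + v').+1, h (k + v')%N 0%N) => //=.
by apply/map_f/map_f; rewrite mem_iota.
Qed.

Lemma degree_update h t u x : (v' <= t)%N -> (u <= t)%N -> size x = f t ->
  degree (G (update h t x) t.+1) u = (degree (G h t) u + count_mem u x)%N.
Proof.
move=> vt ut sx; rewrite MPA_graphS // (MPA_graph_agree E' (@agree_update v' f h t x)).
by rewrite mkseq_update // degree_cat degree_star // ltn_eqF.
Qed.

Lemma endpoint_prob_ge0 h t j : 0 <= endpoint_prob h t j.
Proof. by rewrite divr_ge0. Qed.

Lemma sum_endpoint_prob h t : (v' <= t)%N -> h \in histories v' f t ->
  \sum_(j <- iota 1 t) endpoint_prob h t j = 1.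
Proof.
move=> vt ht; rewrite -mulr_suml -natr_sum (@sum_degree _ t); last first.
  apply: (MPA_graph_on E'_on (t := t)); last by rewrite vt leqnn.
  by move=> s i; exact: histories_valid.
by rewrite size_MPA_graph // divff // gt_eqF // two_cumul_gt0.
Qed.

Let rate t : R := (f t)%:R / (2 * cumul f t)%:R.

Let rate_ge0 t : 0 <= rate t.
Proof. by rewrite divr_ge0. Qed.

(** Given [G(t)], the number of new edges to [u] is binomial with mean [rate t] times the degree. *)
Lemma expect_degreeS t u : (v' <= t)%N -> (1 <= u <= t)%N ->
  expect t.+1 (deg u t.+1) = (1 + rate t) * expect t (deg u t).
Proof.
move=> vt /andP[u1 ut]; rewrite (expectS X_MPA) // -expectZ.
apply: eq_expect => h ht.
have uA : u \in iota 1 t by rewrite mem_iota; lia.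
rewrite (@eq_wsum _ _ _ _ _ _ (fun x => let n := (count_mem u x)%:R in
    deg u t h + 1 * n + 0 * (n * (n - 1)))); last first.
  move=> x; rewrite mem_words => /andP[/eqP sx _].
  by rewrite degree_update // natrD /= mul1r mul0r addr0.
rewrite wsum_count_quadratic ?iota_uniq ?sum_endpoint_prob //.
by rewrite mul0r addr0 mul1r /endpoint_prob /rate; ring.
Qed.

(** The quadratic bound [gamma_ratio_add] is averaged over the binomial number of new edges to
    [u]. *)
Lemma expect_gamma_ratioS t u : (v' <= t)%N -> (1 <= u <= t)%N ->
  expect t.+1 (fun h => gamma_ratio R (degree (G h t.+1) u)) <=
  (1 - rate t / 2 + 3 / 8 * rate t ^+ 2) *
    expect t (fun h => gamma_ratio R (degree (G h t) u)).
Proof.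
move=> vt /andP[u1 ut]; rewrite (expectS X_MPA) // -expectZ.
apply: le_expect => h ht.
have uA : u \in iota 1 t by rewrite mem_iota; lia.
have d0 : (0 < degree (G h t) u)%N by rewrite degree_MPA_graph_gt0 // u1.
set g := gamma_ratio R _; set D := deg u t h.
have D0 : 0 < D by rewrite /D ltr0n.
have g0 : 0 < g by exact: gamma_ratio_gt0.
apply: (@le_trans _ _ (wsum (endpoint_prob h t) (iota 1 t) (f t)
    (fun x => let n := (count_mem u x)%:R in
      g + (- (g * (2 * D)^-1)) * n + g * (3 / 8 / (D * (D + 1))) * (n * (n - 1))))).
  apply: le_wsum => [j _|x]; first exact: endpoint_prob_ge0.
  rewrite mem_words => /andP[/eqP sx _].
  by rewrite degree_update //; exact: gamma_ratio_add.
rewrite wsum_count_quadratic ?iota_uniq ?sum_endpoint_prob //.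
have F0 := two_cumul_gt0 vt.
have pE : endpoint_prob h t u = D / (2 * cumul f t)%:R by [].
have rE : (f t)%:R * endpoint_prob h t u = D * rate t by rewrite pE /rate; ring.
(* With [p] the end-point probability and [r] the rate, the second factorial moment is
   [D r (D r - p)], at most [D (D + 1) r ^ 2]. *)
rewrite [X in g * _ * X](_ : _ = (D * rate t) * (D * rate t - endpoint_prob h t u)); last first.
  by rewrite -rE; ring.
rewrite rE.
have -> : (1 - rate t / 2 + 3 / 8 * rate t ^+ 2) * g =
    g + - (g * (2 * D)^-1) * (D * rate t) + g * (3 / 8) * rate t ^+ 2.
  by field; rewrite gt_eqF.
rewrite lerD2l; set Y := _ * (_ - _).
rewrite [leLHS](_ : _ = g * (3 / 8) * (Y / (D * (D + 1)))); last by ring.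
apply: ler_wpM2l; first by rewrite mulr_ge0 ?(ltW g0).
rewrite ler_pdivrMr ?mulr_gt0 ?addr_gt0 // /Y.
have p0 := endpoint_prob_ge0 h t u; have r0 := rate_ge0 t.
have : 0 <= D * rate t * endpoint_prob h t u by rewrite !mulr_ge0 // ltW.
have : 0 <= D * rate t ^+ 2 by rewrite mulr_ge0 ?sqr_ge0 // ltW.
lra.
Qed.

Lemma cumulS_rate t : (v' <= t)%N ->
  (cumul f t.+1)%:R = (cumul f t)%:R * (1 + 2 * rate t) :> R.
Proof.
move=> vt; rewrite cumulS natrD /rate natrM.
have F0 : 0 < (cumul f t)%:R :> R by rewrite ltr0n cumul_gt0.
by field; rewrite gt_eqF.
Qed.

Lemma rate_le : exists2 K : R, 0 < K & exists t1 : nat, forall t, (t1 <= t)%N ->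
  (v' <= t)%N /\ rate t <= K / t%:R.
Proof.
have [c1 [c2 [a [b [[c1_gt0 c2_gt0 a_gt0 b_gt0] [t1 ft]]]]]] := cumul_quadratic f_linear.
exists (c2 / (2 * a)); first by rewrite divr_gt0 // mulr_gt0.
exists (t1 + v')%N => t tt; split; first by lia.
have [|t_ge1 _ f2 F1 _] := ft t; first by lia.
have t_gt0 : 0 < t%:R :> R by lra.
rewrite /rate ler_pdivrMr ?two_cumul_gt0 //; last by lia.
apply: le_trans f2 _; rewrite natrM.
rewrite [leRHS](_ : _ = c2 * ((cumul f t)%:R / (a * t%:R))); last first.
  by field; rewrite !gt_eqF.
apply: ler_wpM2l; first exact: ltW.
rewrite ler_pdivlMr ?mulr_gt0 //; apply: le_trans F1.
by rewrite [leLHS](_ : _ = a * t%:R ^+ 2) //; ring.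
Qed.

(** In [a ^ 2 / F], with [a] the mean degree, the first-order growth cancels: one step multiplies it
    by [(1 + r) ^ 2 / (1 + 2 r) <= 1 + r ^ 2], and [r ^ 2 = O(1 / t ^ 2)] is summable. Hence
    [a = O(t)], and Markov's inequality applies. *)
Lemma degree_upper_tail u (e : R) : (1 <= u)%N -> 0 < e ->
  exists2 C : R, 0 < C & exists t0 : nat, forall t, (t0 <= t)%N ->
    expect t (fun h => (C * t%:R < deg u t h)%R%:R) <= e.
Proof.
move=> u1 e_gt0; pose a t := expect t (deg u t).
have a_ge0 t : 0 <= a t.
  by rewrite -(expect_cst X_range t 0); apply: le_expect.
have [K K_gt0 [t1 rK]] := rate_le.
have [|t|t tt|C0 [t2 C0_ge0 zC]] :=
  @bounded_of_summable_growth _ (fun t => a t ^+ 2 / (cumul f t)%:R) (K ^+ 2) (t1 + u)%N.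
- exact: sqr_ge0.
- by rewrite divr_ge0 ?sqr_ge0.
- have ut : (u <= t)%N by apply: leq_trans tt; exact: leq_addl.
  have [vt rt] := rK t (leq_trans (leq_addr u t1) tt).
  have r_ge0 := rate_ge0 t.
  have F0 : 0 < (cumul f t)%:R :> R by rewrite ltr0n cumul_gt0.
  rewrite cumulS_rate // /a expect_degreeS ?u1 //.
  rewrite [leLHS](_ : _ = (a t ^+ 2 / (cumul f t)%:R) *
      ((1 + rate t) ^+ 2 / (1 + 2 * rate t))); last first.
    by rewrite /a; field; apply/andP; split; rewrite gt_eqF //; lra.
  apply: ler_wpM2l; first by rewrite divr_ge0 ?sqr_ge0.
  have k_ge : rate t ^+ 2 <= K ^+ 2 / t%:R ^+ 2.
    rewrite -expr_div_n; apply: lerXn2r rt; rewrite nnegrE //.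
    by rewrite divr_ge0 // ltW.
  move: k_ge; set k := _ / _ => k_ge.
  rewrite ler_pdivrMr; last by lra.
  have k_ge0 : 0 <= k by apply: le_trans k_ge; exact: sqr_ge0.
  have := mulr_ge0 r_ge0 k_ge0; lra.
have [c1 [c2 [a0 [b [[_ _ _ b_gt0] [t3 ft]]]]]] := cumul_quadratic f_linear.
(* The [+ 1] gives [C0 b <= S <= S ^ 2], which replaces a square root. *)
pose S := C0 * b + 1.
have S_ge1 : 1 <= S by rewrite /S lerDr mulr_ge0 // ltW.
exists (S / e); first by rewrite divr_gt0 //; lra.
have [t4] := exists_upper_bound [:: t2; t3; v']; rewrite /= andbT => /and3P[t24 t34 vt4].
exists t4 => t tt; have vt := leq_trans vt4 tt.
have [t_ge1 _ _ _ F2] := ft t (leq_trans t34 tt).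
have F0 : 0 < (cumul f t)%:R :> R by rewrite ltr0n cumul_gt0.
have t_gt0 : 0 < t%:R :> R by lra.
have aS : a t <= S * t%:R.
  rewrite -(@ler_pXn2r _ 2) ?nnegrE //; last by rewrite mulr_ge0 //; lra.
  have : a t ^+ 2 <= C0 * (cumul f t)%:R.
    by rewrite -ler_pdivrMr //; exact: zC (leq_trans t24 tt).
  move=> /le_trans; apply; apply: (le_trans (ler_wpM2l C0_ge0 F2)).
  rewrite exprMn mulrA ler_wpM2r ?sqr_ge0 //.
  apply: (@le_trans _ _ S); first by rewrite /S; lra.
  by rewrite expr2 ler_peMr //; lra.
(* Markov's inequality at the level [(S / e) t]. *)
apply: (@le_trans _ _ (expect t (fun h => (e / (S * t%:R)) * deg u t h))).
  apply: le_expect => h _ /=; case: ltP => Hd /=; last first.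
    by rewrite !mulr_ge0 // ?invr_ge0 ?mulr_ge0 //; lra.
  rewrite mulrAC ler_pdivlMr ?mul1r; last by rewrite mulr_gt0 //; lra.
  by move: (ltW Hd); rewrite mulrAC ler_pdivrMr // [_ * e]mulrC.
rewrite expectZ -/(a t) mulrAC ler_pdivrMr; last by rewrite mulr_gt0 //; lra.
by rewrite ler_pM2l.
Qed.

(** A degree below [c t] makes [gamma_ratio] large, which its small mean makes unlikely. Fourth
    powers replace the fractional exponents. *)
Lemma degree_lower_tail u (e : R) : (1 <= u)%N -> 0 < e ->
  exists2 c : R, 0 < c & exists t0 : nat, forall t, (t0 <= t)%N ->
    expect t (fun h => (deg u t h < c * t%:R)%R%:R) <= e.
Proof.
move=> u1 e_gt0; pose g t := expect t (fun h => gamma_ratio R (degree (G h t) u)).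
have g_ge0 t : 0 <= g t.
  rewrite -(expect_cst X_range t 0); apply: le_expect => h _.
  exact/ltW/gamma_ratio_gt0.
have [K K_gt0 [t1 rK]] := rate_le; have [n nK] := exists_nat_ge (4 * K).
have [c1 [c2 [a [b [[_ _ a_gt0 _] [t3 ft]]]]]] := cumul_quadratic f_linear.
(* Times beyond [n >= 4 K] have rate at most [1/4], as [quartic_contraction] requires. *)
have [t2] := exists_upper_bound [:: t1; n; u; t3; 1%N].
rewrite /= andbT => /and5P[t21 t2n t2u t23 t20].
pose C := g t2 ^+ 4 * (cumul f t2)%:R.
have C_ge0 : 0 <= C by rewrite mulr_ge0 // exprn_ge0.
have gC t : (t2 <= t)%N -> g t ^+ 4 * (cumul f t)%:R <= C.
  move=> /subnK <-; elim: (t - t2)%N => [|k]; first by rewrite add0n.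
  rewrite addSn; have st : (t2 <= k + t2)%N by rewrite leq_addl.
  move: (k + t2)%N st => s t2s IH.
  have [|vs rs] := rK s; first exact: leq_trans t2s.
  have s_gt0 : 0 < s%:R :> R by rewrite ltr0n (leq_trans t20).
  have r_ge0 := rate_ge0 s.
  have r_le : rate s <= 1 / 4.
    apply: le_trans rs _; rewrite ler_pdivrMr //.
    have : n%:R <= s%:R :> R by rewrite ler_nat (leq_trans t2n).
    lra.
  apply: le_trans IH; rewrite cumulS_rate //.
  have q : (1 - rate s / 2 + 3 / 8 * rate s ^+ 2) ^+ 4 * (1 + 2 * rate s) <= 1.
    by apply: quartic_contraction; rewrite r_ge0 r_le.
  have gS : g s.+1 <= (1 - rate s / 2 + 3 / 8 * rate s ^+ 2) * g s.
    by apply: expect_gamma_ratioS => //; rewrite u1 (leq_trans t2u).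
  have m_ge0 : 0 <= 1 - rate s / 2 + 3 / 8 * rate s ^+ 2.
    have := sqr_ge0 (rate s); lra.
  have g4 : g s.+1 ^+ 4 <= ((1 - rate s / 2 + 3 / 8 * rate s ^+ 2) * g s) ^+ 4.
    by apply: lerXn2r gS; rewrite nnegrE ?mulr_ge0.
  apply: (@le_trans _ _ (((1 - rate s / 2 + 3 / 8 * rate s ^+ 2) * g s) ^+ 4 *
      ((cumul f s)%:R * (1 + 2 * rate s)))).
    by apply: ler_wpM2r g4; rewrite mulr_ge0 //; lra.
  rewrite exprMn [leLHS](_ : _ = (1 - rate s / 2 + 3 / 8 * rate s ^+ 2) ^+ 4 * (1 + 2 * rate s)
    * (g s ^+ 4 * (cumul f s)%:R)); last by ring.
  by rewrite -[leRHS]mul1r; apply: ler_wpM2r q; rewrite mulr_ge0 ?exprn_ge0.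
(* Chosen so that [16 c ^ 2 C / a <= e ^ 4]; [C + 1] keeps the denominator positive. *)
pose c := Num.sqrt (e ^+ 4 * a / (16 * (C + 1))).
have C1_gt0 : 0 < C + 1 by lra.
have c_gt0 : 0 < c by rewrite sqrtr_gt0 divr_gt0 ?mulr_gt0 ?exprn_gt0.
have c_sqr : c ^+ 2 = e ^+ 4 * a / (16 * (C + 1)).
  by rewrite sqr_sqrtr // divr_ge0 ?mulr_ge0 ?exprn_ge0 // ltW.
exists c => //; exists t2 => t tt.
have [|t_ge1 _ _ F1 _] := ft t; first exact: leq_trans tt.
have [|vt _] := rK t; first exact: leq_trans tt.
have t_gt0 : 0 < t%:R :> R by lra.
have ct_gt0 : 0 < 4 * (c * t%:R) by rewrite !mulr_gt0.
pose y := Num.sqrt (4 * (c * t%:R)).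
have y_ge0 : 0 <= y by exact: sqrtr_ge0.
have y2 : y ^+ 2 = 4 * (c * t%:R) by rewrite sqr_sqrtr // ltW.
(* Markov's inequality: where the degree [d] is below [c t], the square of [y] times its
   [gamma_ratio] is at least [gamma_ratio(d) ^ 2 (4 d - 3) >= 1]. *)
apply: (@le_trans _ _ (y * g t)).
  rewrite /g -expectZ; apply: le_expect => h _ /=.
  have g_gt0 := gamma_ratio_gt0 R (degree (G h t) u).
  case: ltP => Hd /=; last by rewrite mulr_ge0 // ltW.
  rewrite -(@ler_pXn2r _ 2) ?nnegrE ?mulr_ge0 ?(ltW g_gt0) // expr1n exprMn y2.
  have d0 : (0 < degree (G h t) u)%N.
    by apply: degree_MPA_graph_gt0 => //; rewrite u1 (leq_trans t2u).
  apply: le_trans (gamma_ratio_sqr_ge R d0) _; rewrite mulrC.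
  by apply: ler_wpM2r; [exact: sqr_ge0|lra].
rewrite -(@ler_pXn2r _ 4) ?nnegrE ?mulr_ge0 // ?(ltW e_gt0) // exprMn (exprM _ 2 2) y2.
rewrite [leLHS](_ : _ = 16 * c ^+ 2 * (g t ^+ 4 * t%:R ^+ 2)); last by ring.
rewrite c_sqr [leLHS](_ : _ = e ^+ 4 * ((g t ^+ 4 * (a * t%:R ^+ 2)) / (C + 1))); last first.
  by field; rewrite gt_eqF.
apply: ler_piMr; first by rewrite exprn_ge0 // ltW.
rewrite ler_pdivrMr // mul1r.
apply: (@le_trans _ _ (g t ^+ 4 * (cumul f t)%:R)).
  by apply: ler_wpM2l F1; rewrite exprn_ge0.
by have := gC t tt; lra.
Qed.

Definition typical (c C : R) (U : seq nat) t h : bool :=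
  all (fun u => c * t%:R <= deg u t h <= C * t%:R) U.

(** Union bound over [U]; passing to the minimum and maximum of the constants only widens the range
    allowed for each degree. *)
Lemma degrees_tight (U : seq nat) (e : R) : all (leq 1) U -> 0 < e ->
  exists c C : R, [/\ 0 < c, 0 < C & exists t0 : nat, forall t, (t0 <= t)%N ->
    expect t (fun h => (~~ typical c C U t h)%:R) <= e].
Proof.
elim: U e => [|u U IH] e /=.
  move=> _ e_gt0; exists 1, 1; split=> //; exists 0%N => t _.
  by rewrite (expect_cst X_range t) ltW.
move=> /andP[u1 /IH{}IH] e_gt0.
have [|c [C [c_gt0 C_gt0 [t0 UP]]]] := IH (e / 2); first by rewrite divr_gt0.
have [|c' c'_gt0 [t1 lo]] := degree_lower_tail u1 (e := e / 4); first by rewrite divr_gt0.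
have [|C' C'_gt0 [t2 hi]] := degree_upper_tail u1 (e := e / 4); first by rewrite divr_gt0.
exists (Num.min c c'), (Num.max C C'); split.
- by rewrite lt_min c_gt0.
- by rewrite lt_max C_gt0.
have [t3] := exists_upper_bound [:: t0; t1; t2]; rewrite /= andbT => /and3P[t03 t13 t23].
exists t3 => t tt.
apply: (@le_trans _ _ (expect t (fun h => (~~ typical c C U t h)%:R +
  ((deg u t h < c' * t%:R)%R%:R + (C' * t%:R < deg u t h)%R%:R)))).
  apply: le_expect => h _; rewrite -!natrD ler_nat.
  have t_ge0 : 0 <= t%:R :> R by [].
  have [ty|] /= := boolP (typical c C U t h); last first.
    by move=> _; exact: leq_trans (leq_b1 _) (leq_addr _ _).
  have [?|c'd] := ltP (deg u t h); first exact: leq_trans (leq_b1 _) (leq_addr _ _).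
  have [?|C'd] := ltP (C' * t%:R); first exact: leq_b1.
  rewrite [leqRHS](_ : _ = 0%N) // leqn0 eqb0 negbK.
  apply/andP; split.
    apply/andP; split.
      by apply: le_trans c'd; apply: ler_wpM2r => //; rewrite ge_min lexx orbT.
    by apply: (le_trans C'd); apply: ler_wpM2r => //; rewrite le_max lexx orbT.
  apply: sub_all ty => v /andP[cd Cd]; apply/andP; split.
    by apply: le_trans cd; apply: ler_wpM2r => //; rewrite ge_min lexx.
  by apply: (le_trans Cd); apply: ler_wpM2r => //; rewrite le_max lexx.
rewrite !expectD; have := UP t (leq_trans t03 tt).
have := lo t (leq_trans t13 tt); have := hi t (leq_trans t23 tt); lra.
Qed.

(** In the block bound [wsum_hits], each block contributes at least [rho], and the avoidance factor
    is at least [(1 - k / t) ^ f(t)], bounded below because [f(t) <= c2 t]. *)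
Lemma hits_prob_ge (U us : seq nat) (c C : R) :
  {subset us <= U} -> all (leq 1) U -> 0 < c -> 0 < C ->
  exists2 delta : R, 0 < delta & exists t0 : nat, forall t, (t0 <= t)%N ->
    (v' <= t)%N /\ forall h, h \in histories v' f t -> typical c C U t h ->
      delta <= wsum (endpoint_prob h t) (iota 1 t) (f t) (fun x => (hits U us x)%:R).
Proof.
move=> usU /allP U1 c_gt0 C_gt0.
have [c1 [c2 [a [b [[c1_gt0 c2_gt0 a_gt0 b_gt0] [t1 ft]]]]]] := cumul_quadratic f_linear.
(* One block more than [us] has letters, so that the divisor is positive even for an empty [us]. *)
pose M : R := (size us).+1%:R.
have M_ge1 : 1 <= M by rewrite (ler_nat R 1).
have M_gt0 : 0 < M by lra.
(* [rho] multiplies the block length bound [c1 t / (2 M)] by the probability bound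
   [c t / (2 b t ^ 2)]; [k / t] bounds the chance of landing in [U], at most [C t / (2 a t ^ 2)] per
   node. *)
pose rho := c1 * c / (4 * b * M); pose k := (size U)%:R * (C / (2 * a)).
have rho_gt0 : 0 < rho by rewrite divr_gt0 ?mulr_gt0.
have k_ge0 : 0 <= k by rewrite mulr_ge0 // divr_ge0 ?mulr_ge0 // ltW.
exists (rho ^+ size us * expR (- (2 * k * c2))).
  by rewrite mulr_gt0 ?exprn_gt0 ?expR_gt0.
have [n1 n1P] := exists_nat_ge (2 * M / c1); have [n2 n2P] := exists_nat_ge (2 * k).
have [t0] := exists_upper_bound [:: t1; v'; n1; n2; \max_(u <- U) u].
rewrite /= andbT => /and5P[t01 t0v t0n1 t0n2 t0U].
exists t0 => t tt; have vt : (v' <= t)%N by exact: leq_trans tt.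
split=> // h ht /allP ty.
have [|t_ge1 f1 f2 F1 F2] := ft t; first exact: leq_trans tt.
have t_gt0 : 0 < t%:R :> R by lra.
have F0 : 0 < (cumul f t)%:R :> R by rewrite ltr0n cumul_gt0.
have k_le : k / t%:R <= 1 / 2.
  rewrite ler_pdivrMr //; have : n2%:R <= t%:R :> R by rewrite ler_nat (leq_trans t0n2).
  lra.
have f_ge : 2 * M <= (f t)%:R.
  apply: le_trans f1; rewrite [leRHS]mulrC -ler_pdivrMr //; apply: (le_trans n1P).
  by rewrite ler_nat (leq_trans t0n1).
pose L := (f t %/ (size us).+1)%N.
(* As [f t >= 2 M], rounding down costs at most a factor [2]. *)
have L_ge : (f t)%:R / (2 * M) <= L%:R.
  rewrite ler_pdivrMr ?mulr_gt0 //.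
  have : (f t < L.+1 * (size us).+1)%N by rewrite -ltn_divLR.
  rewrite -(ltr_nat R) natrM -(natr1 L) -/M; lra.
have Lf : (size us * L <= f t)%N.
  by apply: leq_trans (leq_trunc_div (f t) (size us).+1); rewrite mulnC leq_mul2l leqnSn orbT.
have U_iota : {subset U <= iota 1 t}.
  move=> u uU; rewrite mem_iota add1n ltnS.
  by rewrite [(1 <= u)%N]U1 // (leq_trans _ tt) // (leq_trans _ t0U) // leq_bigmax_seq.
have p_le u : u \in U -> endpoint_prob h t u <= C / (2 * a) / t%:R.
  move=> /ty /andP[_ du]; rewrite ler_pdivrMr ?two_cumul_gt0 //.
  apply: le_trans du _; rewrite natrM.
  rewrite [leRHS](_ : _ = C * ((cumul f t)%:R / (a * t%:R))); last first.
    by field; rewrite !gt_eqF.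
  apply: ler_wpM2l; first exact: ltW.
  rewrite ler_pdivlMr ?mulr_gt0 //; apply: le_trans F1.
  by rewrite [leLHS](_ : _ = a * t%:R ^+ 2) //; ring.
have p_ge u : u \in U -> rho <= L%:R * endpoint_prob h t u.
  move=> /ty /andP[du _].
  apply: (@le_trans _ _ ((c1 * t%:R / (2 * M)) * (c * t%:R / (2 * (b * t%:R ^+ 2))))).
    by rewrite le_eqVlt; apply/orP; left; apply/eqP; rewrite /rho; field; rewrite !gt_eqF.
  apply: ler_pM.
  - by rewrite divr_ge0 ?mulr_ge0 // ltW.
  - by rewrite divr_ge0 ?mulr_ge0 ?exprn_ge0 // ltW.
  - by apply: le_trans L_ge; apply: ler_wpM2r f1; rewrite invr_ge0 mulr_ge0 // ltW.
  rewrite /endpoint_prob natrM; apply: ler_pM => //.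
  - by rewrite mulr_ge0 // ltW.
  - by rewrite invr_ge0 !mulr_ge0 ?exprn_ge0 // ltW.
  - by rewrite lef_pV2 ?posrE ?mulr_gt0 ?exprn_gt0 // ler_pM2l.
pose q := \sum_(j <- iota 1 t | j \notin U) endpoint_prob h t j.
have q_ge : 1 - k / t%:R <= q.
  rewrite lerBlDr -[leLHS](sum_endpoint_prob vt ht) (bigID (fun j => j \in U)) /=.
  rewrite [leLHS]addrC lerD2l.
  apply: (@le_trans _ _ (\sum_(j <- iota 1 t | j \in U) (C / (2 * a) / t%:R))).
    by apply: ler_sum => j; exact: p_le.
  rewrite big_const_seq iter_addr_0 -[leLHS]mulr_natl /k -[leRHS]mulrA.
  apply: ler_wpM2r; first by rewrite divr_ge0 // divr_ge0 ?mulr_ge0 // ltW.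
  rewrite ler_nat -size_filter; apply: uniq_leq_size; first exact/filter_uniq/iota_uniq.
  by move=> j; rewrite mem_filter => /andP[].
have prod_ge s : {subset s <= U} ->
    rho ^+ size s <= \prod_(u <- s) (L%:R * endpoint_prob h t u).
  elim: s => [|u s IH] sU; first by rewrite big_nil.
  rewrite big_cons exprS; apply: ler_pM; rewrite ?exprn_ge0 ?(ltW rho_gt0) //.
    by apply/p_ge/sU/mem_head.
  by apply: IH => v vs; apply: sU; rewrite inE vs orbT.
have := wsum_hits (fun j _ => endpoint_prob_ge0 h t j) (sum_endpoint_prob vt ht)
  (iota_uniq 1 t) L (f t - size us * L) (fun u uus => U_iota u (usU u uus)) usU.
rewrite subnKC // -/q; apply: le_trans; apply: ler_pM.
- by rewrite exprn_ge0 // ltW.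
- exact: expR_ge0.
- exact: prod_ge.
apply: (@le_trans _ _ (expR (- (2 * (k / t%:R) * (f t)%:R)))).
  rewrite ler_expR lerN2.
  apply: (@le_trans _ _ (2 * (k / t%:R) * (c2 * t%:R))).
    by apply: ler_wpM2l f2; rewrite mulr_ge0 // divr_ge0.
  by rewrite le_eqVlt; apply/orP; left; apply/eqP; field; rewrite gt_eqF.
apply: (le_trans (exp_one_sub_ge _ _)); first by rewrite k_le divr_ge0.
apply: lerXn2r q_ge; rewrite nnegrE; first by lra.
by apply: sumr_ge0 => j _; exact: endpoint_prob_ge0.
Qed.

(** * Every pattern occurs almost surely *)

Definition no_hit (U us : seq nat) t0 t h : bool :=
  all (fun s => ~~ hits U us (mkseq (h s) (f s))) (iota t0 (t - t0)).

Lemma no_hit_agree U us t0 t h h' : (v' <= t0)%N -> agree v' f t h h' ->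
  no_hit U us t0 t h = no_hit U us t0 t h'.
Proof.
move=> vt0 hh; apply: eq_in_all => s; rewrite mem_iota => st.
congr (~~ hits _ _ _); apply/eq_in_map => i; rewrite mem_iota add0n => /= ifs.
by apply: hh => //; lia.
Qed.

Lemma no_hitS U us t0 t h x : (v' <= t0 <= t)%N -> size x = f t ->
  no_hit U us t0 t.+1 (update h t x) = no_hit U us t0 t h && ~~ hits U us x.
Proof.
move=> /andP[vt0 t0t] sx; rewrite /no_hit subSn // -addn1 iotaD all_cat /= andbT.
rewrite subnKC // mkseq_update //; congr (_ && _).
exact: (@no_hit_agree _ _ _ _ _ _ vt0 (@agree_update v' f h t x)).
Qed.

Lemma no_hit_forever_negligible (U us : seq nat) t0 :
  {subset us <= U} -> all (leq 1) U -> (v' <= t0)%N ->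
  P.-negligible [set w | forall s, (t0 <= s)%N ->
                   ~~ hits U us (mkseq (X s ^~ w) (f s))].
Proof.
move=> usU U1 vt0; set B := [set w | _].
(* Each event of this countable intersection depends on a finite history, which gives
   measurability. *)
have BE : B = \bigcap_t [set w | no_hit U us t0 t (path w)].
  apply/seteqP; split=> [w Bw t _|w Bw s st] /=.
    by apply/allP => s; rewrite mem_iota => /andP[+ _]; exact: Bw.
  have /allP := Bw s.+1 I; apply.
  by rewrite mem_iota st subnKC ?ltnSn // ltnW.
have agr t h h' : agree v' f t h h' -> no_hit U us t0 t h = no_hit U us t0 t h'.
  exact: no_hit_agree.
have mB : measurable B.
  rewrite BE; apply: bigcap_measurable => // t _.
  exact: (measurable_history_event X_range (@agr t)).
apply/negligibleP => //; pose p t := expect t (fun h => (no_hit U us t0 t h)%:R).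
have PB : P B = (fine (P B))%:E by rewrite fineK ?fin_num_measure.
set beta := fine (P B) in PB.
have p_ge t : beta <= p t.
  rewrite -lee_fin -PB -(prob_history_event X_range (@agr t)).
  apply: le_measure; rewrite ?inE //.
    exact: (measurable_history_event X_range (@agr t)).
  by rewrite BE => w /(_ t I).
apply: (etrans PB); congr EFin; apply/eqP; rewrite eq_le fine_ge0 ?measure_ge0 // andbT.
rewrite leNgt; apply/negP => beta_gt0.
have e_gt0 : 0 < beta / 2 by rewrite divr_gt0.
have [c [C [c_gt0 C_gt0 [t1 tight]]]] := degrees_tight U1 e_gt0.
have [delta delta_gt0 [t2 hitP]] := hits_prob_ge usU U1 c_gt0 C_gt0.
have [t3] := exists_upper_bound [:: t0; t1; t2]; rewrite /= andbT => /and3P[t03 t13 t23].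
(* The process is typical without a hit so far with probability at least [beta - beta / 2], and then
   hits with probability at least [delta]. *)
have pS t : (t3 <= t)%N -> p t.+1 <= p t - delta * (beta / 2).
  move=> t3t; have t0t : (t0 <= t)%N by exact: leq_trans t3t.
  have [vt {}hitP] := hitP t (leq_trans t23 t3t).
  have := tight t (leq_trans t13 t3t); set nt := expect t _ => ntP.
  (* The last term pays for the atypical histories, where only [W >= 0] is known. *)
  apply: (@le_trans _ _ (p t + ((- delta) * p t + delta * nt))); last first.
    have : delta * (beta / 2) <= delta * (p t - nt).
      by apply: ler_wpM2l; [exact: ltW|have := p_ge t; lra].
    lra.
  rewrite /p /nt (expectS X_MPA) // -!expectZ -!expectD; apply: le_expect => h ht.
  rewrite (@eq_wsum _ _ _ _ _ _ (fun x => (no_hit U us t0 t h)%:R *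
      (1 - (hits U us x)%:R))); last first.
    move=> x; rewrite mem_words => /andP[/eqP sx _]; rewrite no_hitS ?vt0 //.
    by case: (no_hit _ _ _ _ _); case: (hits _ _ _); rewrite /= ?mul1r ?mul0r ?subrr ?subr0.
  rewrite wsumZ wsumB wsum_cst ?sum_endpoint_prob //.
  set W := wsum _ _ _ _.
  have W_ge0 : 0 <= W.
    rewrite -(wsum_cst (sum_endpoint_prob vt ht) (f t) 0).
    by apply: le_wsum => // j _; exact: endpoint_prob_ge0.
  have := hitP h ht; case: (typical _ _ _ _ _) => [/(_ isT)|_] /=; rewrite -/W;
    case: (no_hit _ _ _ _ _) => /=; lra.
pose g := delta * (beta / 2).
have g_gt0 : 0 < g by rewrite mulr_gt0.
have pn n : p (n + t3)%N <= p t3 - n%:R * g.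
  elim: n => [|n IH]; first by rewrite add0n mul0r subr0.
  rewrite addSn -natr1; have := pS (n + t3)%N (leq_addl _ _); rewrite -/g; lra.
(* After this many steps the bound on [p] would be negative. *)
have [n nP] := exists_nat_ge ((p t3 + 1) / g).
have := pn n; have := p_ge (n + t3)%N; move: nP; rewrite ler_pdivrMr //; lra.
Qed.

End Tightness.

(** * The limit *)

Lemma multiplicity_cat (E E1 : dmultigraph) a b :
  multiplicity (E ++ E1) a b = (multiplicity E a b + multiplicity E1 a b)%N.
Proof. exact: count_cat. Qed.

Lemma multiplicityC (E : dmultigraph) a b : multiplicity E a b = multiplicity E b a.
Proof. by apply: eq_count => e; rewrite orbC. Qed.

Lemma multiplicity_star n (x : seq nat) a b : a != n ->
  multiplicity [seq (n, y) | y <- x] a b = if b == n then count_mem a x else 0%N.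
Proof.
move=> an; rewrite /multiplicity count_map; have [->|bn] := eqVneq b n.
  by apply: eq_count => y /=; rewrite !xpair_eqE [n == a]eq_sym (negbTE an) eqxx.
rewrite (eq_count (a2 := pred0)) ?count_pred0 // => y /=.
by rewrite !xpair_eqE ![n == _]eq_sym (negbTE an) (negbTE bn).
Qed.

Lemma multiplicity_fresh n (E : dmultigraph) a b : dmultigraph_on n E ->
  (n < b)%N -> multiplicity E a b = 0%N.
Proof.
move=> En nb; apply/eqP; rewrite -leqn0 leqNgt -has_count; apply/hasPn => e /En.
by case: e => x y /=; rewrite !xpair_eqE; lia.
Qed.

Section Limit.
Variables (v' : nat) (E' : dmultigraph) (f : nat -> nat) (h : nat -> nat -> nat).
Local Notation G t := (MPA_graph v' E' f h t).
Hypothesis E'_on : dmultigraph_on v' E'.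
Hypothesis h_valid : forall s i, (v' <= s)%N -> (i < f s)%N -> (1 <= h s i <= s)%N.

Lemma multiplicity_mono s t a b : (s <= t)%N ->
  (multiplicity (G s) a b <= multiplicity (G t) a b)%N.
Proof.
move=> /subnK <-; elim: (t - s)%N => // k /leq_trans; apply; rewrite addSn.
have [vk|kv] := leqP v' (k + s); last by rewrite !MPA_graph_initial // ltnW.
by rewrite MPA_graphS // multiplicity_cat leq_addr.
Qed.

(** Edges added after time [s] start at nodes beyond [s]. *)
Lemma multiplicity_stable s t a b : (v' <= s)%N -> (a <= s)%N -> (b <= s)%N ->
  (s <= t)%N -> multiplicity (G t) a b = multiplicity (G s) a b.
Proof.
move=> vs sa sb /subnK <-; elim: (t - s)%N => // k <-.
have sk : (s <= k + s)%N := leq_addl _ _.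
rewrite addSn MPA_graphS ?(leq_trans vs) // multiplicity_cat multiplicity_star.
  by rewrite ltn_eqF ?addn0 // ltnS (leq_trans sb).
by rewrite ltn_eqF // ltnS (leq_trans sa).
Qed.

Lemma MPA_limit_Rado :
  (forall U us t0, {subset us <= U} -> all (leq 1) U -> (v' <= t0)%N ->
     exists2 s, (t0 <= s)%N & hits U us (mkseq (h s) (f s))) ->
  Rado_multigraph (MPA_limit v' E' f h).
Proof.
move=> hitP; split.
- exact: countableP.
(* Shifting down by one maps the nodes onto all natural numbers. *)
- move=> /(finite_image (fun x : node => (val x).-1)) fin.
  apply: infinite_nat; apply: sub_finite_set fin => k _.
  by exists (exist (fun n => 0 < n)%N k.+1 isT).
- by move=> x y xy; split=> //; exists 1%N.
- move=> j x y [xy [t t1 jt]]; split; first by move=> yx; apply: xy.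
  by exists t; rewrite // multiplicityC.
- by move=> j x [].
- by move=> j x y [xy [t t1 jt]]; split=> //; exists t => //; exact: ltnW.
- move=> x y; have [s] := exists_upper_bound [:: v'; val x; val y].
  rewrite /= andbT => /and3P[vs xs ys].
  (* The multiplicity is frozen once both nodes are present; an arbitrary [t] is compared with [s]
     at [maxn t s]. *)
  exists (multiplicity (G s) (val x) (val y)).+1 => -[_ [t _]].
  apply/negP; rewrite -leqNgt.
  apply: leq_trans (multiplicity_mono _ _ (leq_maxl t s)) _.
  by rewrite (multiplicity_stable vs xs ys) // leq_maxr.
move=> n m u u_inj; pose U := [seq val (u i) | i <- enum 'I_n].
(* Each prescribed node is repeated as often as (A4) demands. *)
pose us := flatten [seq nseq (m i) (val (u i)) | i <- enum 'I_n].
have uU i : val (u i) \in U by apply: map_f; rewrite mem_enum.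
have count_us i : count_mem (val (u i)) us = m i.
  rewrite /us count_flatten -map_comp sumnE big_map big_enum /= (bigD1 i) //=.
  rewrite count_nseq /= eqxx mul1n big1 ?addn0 // => k ki.
  rewrite count_nseq /= (_ : val (u k) == val (u i) = false) ?mul0n //.
  by apply: contraNF ki => /eqP/val_inj/u_inj ->.
have [t0] := exists_upper_bound (v' :: U); rewrite /= => /andP[vt0 /allP Ut0].
have [|||s t0s /allP hs] := hitP U us t0 => //.
- by move=> x /flattenP[_ /mapP[i _ ->]]; rewrite mem_nseq => /andP[_ /eqP ->].
- by apply/allP => x /mapP[i _ ->]; exact: valP (u i).
have vs : (v' <= s)%N := leq_trans vt0 t0s.
have us_le i : (val (u i) <= s)%N by apply: leq_trans t0s; exact: Ut0.
(* The witness is the node whose edges are row [s]; it is absent from [G s], so this row alone gives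
   its multiplicities. *)
exists (exist (fun n => 0 < n)%N s.+1 isT) => i /=.
have mult_s : multiplicity (G s.+1) (val (u i)) s.+1 = m i.
  rewrite MPA_graphS // multiplicity_cat multiplicity_star; last first.
    by rewrite ltn_eqF // ltnS.
  rewrite eqxx (eqP (hs _ (uU i))) count_us (@multiplicity_fresh s) //.
  apply: (MPA_graph_on E'_on (t := s)); last by rewrite vs leqnn.
  by move=> s' k /andP[vs' _]; exact: h_valid.
split.
  split; last by exists s.+1; rewrite //= mult_s.
  by move=> us'; have := us_le i; rewrite us' /= ltnn.
move=> [_ [t _ /=]]; apply/negP; rewrite -leqNgt.
apply: leq_trans (multiplicity_mono _ _ (leq_maxl t s.+1)) _.
rewrite (@multiplicity_stable s.+1) ?mult_s ?leq_maxr //.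
- exact: leqW.
- exact/leqW/us_le.
Qed.

End Limit.

Theorem theorem3p2 (R : realType) (d : measure_display) (T : measurableType d)
    (P : probability T R)
    (v' : nat) (E' : dmultigraph) (f : nat -> nat)
    (X : nat -> nat -> {RV P >-> nat})
    (V : Type) (rado : mstruct V) :
  dmultigraph_on v' E' -> loopless E' -> no_isolated v' E' ->
  f 0%N = size E' ->
  (forall t : nat, (1 <= t <= v' - 1)%N -> f t = 0%N) ->
  (forall t : nat, (v' <= t)%N -> (1 <= f t)%N) ->
  Theta_linear R f ->
  is_MPA v' E' f X ->
  Rado_multigraph rado ->
  {ae P, forall w : T, miso (MPA_limit v' E' f (fun t i => X t i w)) rado}.
Proof.
move=> E'_on _ E'_noiso f0 f_eq0 f_ge1 f_lin X_MPA radoE.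
(* The failure events are indexed by finite data, hence countable in number. The side conditions sit
   inside the event, so that all triples can be enumerated. *)
pose B (x : seq nat * seq nat * nat) := let: (U, us, t0) := x in
  [set w | [/\ {subset us <= U}, all (leq 1) U, (v' <= t0)%N &
    forall s, (t0 <= s)%N -> ~~ hits U us (mkseq (X s ^~ w) (f s))]].
have B_negl x : P.-negligible (B x).
  case: x => [[U us] t0]; have [[usU U1 vt0]|nC] :=
      pselect [/\ {subset us <= U}, all (leq 1) U & (v' <= t0)%N]; last first.
    apply: negligibleS (negligible_set0 P) => w [usU U1 vt0 _]; exact: nC.
  apply: negligibleS (no_hit_forever_negligible E'_on E'_noiso f0 f_eq0 f_ge1
    f_lin X_MPA usU U1 vt0) => w [_ _ _]; exact.
have : P.-negligible (\bigcup_k (if unpickle k is Some x then B x else set0)).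
  apply: negligible_bigcup => k; case: (unpickle k) => [x|]; first exact: B_negl.
  exact: negligible_set0.
(* Off this null set every pattern recurs, so the limit is a Rado multigraph and uniqueness
   applies. *)
apply: negligibleS => w /= nw; apply: contrapT => nB; apply: nw.
apply: Rado_unique radoE; apply: MPA_limit_Rado => // [s i|U us t0 usU U1 vt0].
  by case: X_MPA => + _; exact.
apply: contrapT => no; apply: nB; exists (pickle (U, us, t0)) => //.
rewrite pickleK; split=> // s ts; apply/negP => hs; apply: no; exists s => //.
Qed.
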